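(* Let $k$ be a field, $U$ a $4$-dimensional $k$-vector space, $P=\mathrm{Sym}_\bullet U$, $\Phi_3\in D_3U^*$, and $\mathfrak A=P/\operatorname{ann}\Phi_3$. Assume that $\operatorname{ann}\Phi_3$ contains no nonzero linear form and that $x\in U$ is a weak Lefschetz element on $\mathfrak A$. Fix $x^*\in U^*$ with $x^*(x)=1$, put $U_0=\ker x^*$, fix a basis $y,z,w$ of $U_0$, and let $\mathrm{SM}$ be the $3\times3$ symmetric matrix over $k$ defined in the context. If $\mathrm{SM}$ has rank at least two, then the defining ideal $\operatorname{ann}\Phi_3$ of $\mathfrak A$ is the generalized sum of two linked codimension three perfect ideals.
   Context: $U^*=\mathrm{Hom}_k(U,k)$. $P=\mathrm{Sym}_\bullet U$ is the standard graded polynomial ring and $D_\bullet U^*$ is the divided power algebra, with $D_iU^*=\mathrm{Hom}_k(\mathrm{Sym}_iU,k)$. $D_\bullet U^*$ is a $P$-module: for $u\in\mathrm{Sym}_aU$, $\nu\in D_bU^*$, $u\nu=u(\nu)\in D_{b-a}U^*$ is given by $(u\nu)(u')=\nu(uu')$ for $u'\in\mathrm{Sym}_{b-a}U$ (and $u\nu=0$ if $a>b$). $\operatorname{ann}\Phi=\{f\in P: f\Phi=0\}$. An element $\ell\in U$ is a weak Lefschetz element on $\mathfrak A$ if multiplication by $\ell$, $\mathfrak A_i\to\mathfrak A_{i+1}$, has maximal rank for every $i$. Let $p:U\to U^*$ be $p(u)=u(x\Phi_3)$; under the hypotheses it is an isomorphism. Let $\langle u,u'\rangle=[u\,p^{-1}(u'\Phi_3)](\Phi_3)\in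 k$ for $u,u'\in\mathrm{Sym}_2U_0$ (a symmetric bilinear form). Then $$\mathrm{SM}=\begin{bmatrix}\langle z^2,w^2\rangle-\langle zw,zw\rangle&\langle zw,yw\rangle-\langle yz,w^2\rangle&\langle yz,zw\rangle-\langle z^2,yw\rangle\\ \langle yw,zw\rangle-\langle yz,w^2\rangle&\langle y^2,w^2\rangle-\langle yw,yw\rangle&\langle yz,yw\rangle-\langle y^2,zw\rangle\\ \langle yz,zw\rangle-\langle yw,z^2\rangle&\langle yw,yz\rangle-\langle y^2,zw\rangle&\langle y^2,z^2\rangle-\langle yz,yz\rangle\end{bmatrix}.$$ A proper ideal $J$ of $P$ is perfect if $\operatorname{grade}J=\operatorname{pd}_P(P/J)$. An ideal $K$ of the Gorenstein ring $P$ is called a generalized sum of (two) linked (codimension $g$ perfect) ideals if there are a grade $g$ perfect ideal $J\subseteq K$ of $P$ and an injective $P$-module homomorphism $\theta:\mathrm{Ext}^g_P(P/J,P)\to P/J$ with $\operatorname{im}\theta=K/J$, and $\operatorname{grade}K\ge g+1$. Here $g=3$. *)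

(* Defs.v *)
From HB Require Import structures.
From mathcomp Require Import all_boot all_algebra ring_quotient.
From mathcomp Require Import boolp functions.
From mathcomp Require Export mpoly.

Set Implicit Arguments.
Unset Strict Implicit.
Unset Printing Implicit Defensive.

Import GRing.Theory.
Local Open Scope ring_scope.
Local Open Scope quotient_scope.

(** Submodules are [submodClosed] predicates; ideals of [R] are submodules of
    [R^o].  The library has the additive quotient [Quotient.quot] and
    quotient rings, but no quotient modules. *)

Section QuotientModule.
Variables (R : nzRingType) (V : lmodType R) (S : submodClosed V).

Definition zsub (v : V) : bool := v \in (S : {pred V}).

Lemma zsub_zmod_closed : zmod_closed zsub.
Proof.
split=> [|u v]; first exact: (rpred0 S).
rewrite -[u - v]addrC -scaleN1r => Su Sv.
by apply: (rpredD (S := S)) => //; apply: (rpredZ (s := S)).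
Qed.

HB.instance Definition _ := GRing.isZmodClosed.Build V zsub zsub_zmod_closed.

Definition qmod : Type := Quotient.quot (GRing.ZmodClosed.clone V zsub _).

HB.instance Definition _ := GRing.Zmodule.on qmod.

Definition qpi (v : V) : qmod := \pi_(Quotient.quot (GRing.ZmodClosed.clone V zsub _)) v.

Lemma qpiP u v : (qpi u = qpi v) <-> (u - v \in S).
Proof.
rewrite -[_ \in S]/(u - v \in zsub) Quotient.idealrBE.
by split=> [/eqP|/eqP].
Qed.

Lemma qpi_surj (q : qmod) : exists v, q = qpi v.
Proof. by exists (repr q); rewrite /qpi reprK. Qed.

Lemma qpiB : zmod_morphism qpi.
Proof. by move=> u v; rewrite /qpi raddfB. Qed.

HB.instance Definition _ := GRing.isZmodMorphism.Build V qmod qpi qpiB.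

Definition qscale (a : R) (q : qmod) : qmod := qpi (a *: repr q).

Lemma qpi_scale a v : qscale a (qpi v) = qpi (a *: v).
Proof.
apply/qpiP; rewrite -scalerBr; apply: (rpredZ (s := S)).
by apply/qpiP; rewrite {1}/qpi reprK.
Qed.

Lemma qscaleA a b q : qscale a (qscale b q) = qscale (a * b) q.
Proof. by have [v ->] := qpi_surj q; rewrite !qpi_scale scalerA. Qed.

Lemma qscale1 : left_id 1 qscale.
Proof. by move=> q; have [v ->] := qpi_surj q; rewrite qpi_scale scale1r. Qed.

Lemma qscaleDr : right_distributive qscale +%R.
Proof.
move=> a q r; have [v ->] := qpi_surj q; have [w ->] := qpi_surj r.
by rewrite -raddfD !qpi_scale -raddfD scalerDr.
Qed.

Lemma qscaleDl q : {morph qscale^~ q : a b / a + b}.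
Proof.
by move=> a b; have [v ->] := qpi_surj q; rewrite !qpi_scale -raddfD scalerDl.
Qed.

HB.instance Definition _ :=
  GRing.Zmodule_isLmodule.Build R qmod qscaleA qscale1 qscaleDr qscaleDl.

Lemma qpi_scalable : scalable qpi.
Proof. by move=> a v; rewrite -qpi_scale. Qed.

HB.instance Definition _ := GRing.isScalable.Build R V qmod *:%R qpi qpi_scalable.

End QuotientModule.

Section Resolutions.
Variable R : comNzRingType.

Definition projective (M : lmodType R) : Prop :=
  forall (N N' : lmodType R) (s : {linear N -> N'}) (f : {linear M -> N'}),
    (forall y, exists x, s x = y) ->
    exists h : {linear M -> N}, forall m, s (h m) = f m.

Record resolution (M : lmodType R) := Resolution {
  term :> nat -> lmodType R;
  diff : forall i, {linear term i.+1 -> term i};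
  aug : {linear term 0%N -> M};
  term_proj : forall i, projective (term i);
  aug_surj : forall m, exists v, aug v = m;
  aug_exact : forall v, aug v = 0 <-> exists w, diff 0%N w = v;
  diff_exact : forall i v, diff i v = 0 <-> exists w, diff i.+1 w = v
}.

Definition pd_le (M : lmodType R) (n : nat) : Prop :=
  exists F : resolution M, forall i, (n < i)%N -> forall v : F i, v = 0.

Definition pd_eq (M : lmodType R) (n : nat) : Prop :=
  pd_le M n /\ forall m, pd_le M m -> (n <= m)%N.

End Resolutions.

(** [Ext F i N] is the [i]-th cohomology of [Hom_R(F, N)]; it is [Ext^i(M, N)]
    for [F] a projective resolution of [M]. *)

Section Ext.
Variables (R : comNzRingType) (M : lmodType R) (F : resolution M).

Definition is_cobound (N : lmodType R) (i : nat) : (F i -> N) -> Prop :=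
  match i with
  | 0%N => fun f => f = 0
  | j.+1 => fun f => exists g : {linear F j -> N}, f = g \o diff F j
  end.

Lemma is_cobound0 (N : lmodType R) i : @is_cobound N i 0.
Proof. by case: i => // j; exists (\0 : {linear F j -> N}). Qed.

Lemma is_cobound_lin (N : lmodType R) i c (f g : F i -> N) :
  is_cobound f -> is_cobound g -> is_cobound (c *: f + g).
Proof.
case: i f g => [|j] f g; first by move=> -> ->; rewrite scaler0 addr0.
by move=> [f' ->] [g' ->]; exists ((c \*: f') \+ g' : {linear F j -> N}).
Qed.

Variables (i : nat) (N : lmodType R).

Definition cocycle (f : F i -> N) : bool :=
  `[< linear f /\ forall v, f (diff F i v) = 0 >].

Lemma cocycle_submod_closed : submod_closed cocycle.
Proof.
split=> [|c f g /asboolP[lf f0] /asboolP[lg g0]]; apply/asboolP; split.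
- by move=> a u v; rewrite /= scaler0 addr0.
- by [].
- move=> a u v; rewrite !fctE lf lg !scalerDr !scalerA [c * a]mulrC.
  by rewrite addrACA.
- by move=> v; rewrite !fctE f0 g0 scaler0 addr0.
Qed.

HB.instance Definition _ :=
  GRing.isSubmodClosed.Build R (F i -> N) cocycle cocycle_submod_closed.

Definition cocycles : Type := {f : F i -> N | cocycle f}.

HB.instance Definition _ := SubChoice.on cocycles.
HB.instance Definition _ := [SubChoice_isSubLmodule of cocycles by <:].

Definition coboundary (z : cocycles) : bool := `[< is_cobound (val z) >].

Lemma coboundary_submod_closed : submod_closed coboundary.
Proof.
split; first by apply/asboolP; exact: is_cobound0.
by move=> c y z /asboolP hy /asboolP hz; apply/asboolP; exact: is_cobound_lin.
Qed.

HB.instance Definition _ :=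
  GRing.isSubmodClosed.Build R cocycles coboundary coboundary_submod_closed.

Definition Ext : lmodType R := qmod (GRing.SubmodClosed.clone R _ coboundary _).

End Ext.

Section Grade.
Variable R : comNzRingType.
Implicit Types (I J K : submodClosed R^o) (s : seq R).

Definition quo I : lmodType R := qmod I.

(** [f] lies in the ideal generated by [s]. *)
Definition gen s (f : R) : Prop :=
  exists c : nat -> R, f = \sum_(i < size s) c i * s`_i.

Definition regular_seq s : Prop :=
  (forall i, (i < size s)%N ->
     forall f, gen (take i s) (s`_i * f) -> gen (take i s) f) /\
  ~ gen s 1.

Definition grade_ge I (n : nat) : Prop :=
  exists s, [/\ size s = n, {subset s <= I} & regular_seq s].

Definition grade_eq I (n : nat) : Prop :=
  grade_ge I n /\ forall m, grade_ge I m -> (m <= n)%N.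

Definition proper I : Prop := (1 : R^o) \notin I.

Definition perfect I : Prop :=
  proper I /\ exists g, grade_eq I g /\ pd_eq (quo I) g.

Definition generalized_linked_sum (g : nat) K : Prop :=
  exists J,
    [/\ perfect J, grade_eq J g, {subset J <= K},
        (exists (F : resolution (quo J)) (theta : {linear Ext F g R^o -> quo J}),
           injective theta /\
           forall q : quo J,
             (exists e, theta e = q) <-> (exists2 f, f \in K & q = qpi J f))
      & grade_ge K g.+1].

End Grade.

Section Macaulay.
Variables (k : fieldType) (n : nat).
Local Notation P := {mpoly k[n.+1]}.

Definition Sym (i : nat) : vectType k := dhomog n.+1 k i.

(** [DP i] is [D_i U^*], where [dim U = n.+1]. *)
Definition DP (i : nat) : vectType k := 'Hom(Sym i, k^o).

Definition hcomp (i : nat) (f : P) : Sym i := DHomog (pihomogP mdeg i f).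

Definition mulS a b (u : Sym a) (v : Sym b) : Sym (a + b) :=
  DHomog (dhomogM (valP u) (valP v)).

(** If [a > b] then [b - a = 0] and [u * u'] has degree [a], so
    [hcomp b (u * u') = 0] and [contr u nu = 0], as it should be. *)
Definition contr a b (u : Sym a) (nu : DP b) : DP (b - a) :=
  linfun (fun u' : Sym (b - a) => nu (hcomp b (val u * val u')) : k^o).

Lemma contrE a b (u : Sym a) (nu : DP b) (u' : Sym (b - a)) :
  contr u nu u' = nu (hcomp b (val u * val u')).
Proof.
rewrite /contr.
have lin_f : linear (fun u' : Sym (b - a) => nu (hcomp b (val u * val u')) : k^o).
  move=> c v w; rewrite -linearP; congr (nu _); apply/val_inj => /=.
  by rewrite mulrDr -scalerAr linearP.
pose F := GRing.isLinear.Build k _ _ _ _ lin_f.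
pose f : {linear Sym (b - a) -> k^o} := HB.pack
  (fun u' : Sym (b - a) => nu (hcomp b (val u * val u')) : k^o) F.
exact: (lfunE f).
Qed.

Lemma contr_linear a b (nu : DP b) : linear (fun u : Sym a => contr u nu).
Proof.
move=> c v w; apply/lfunP => u.
rewrite add_lfunE scale_lfunE !contrE -linearP; congr (nu _).
by apply/val_inj; rewrite /= mulrDl -scalerAl linearP.
Qed.

(** For [f] in [P] and [nu] in [D_b], the component of [f nu] in [D_(b-a)] is
    [f_a nu], where [f_a = hcomp a f], and the components with [a > b] vanish. *)
Definition ann b (nu : DP b) (f : P^o) : bool :=
  `[< forall a, contr (hcomp a f) nu = 0 >].

Lemma pihomogMl a b (f g : P) : f \is (a.-homog) ->
  pihomog mdeg b (f * g) =
  if (a <= b)%N then f * pihomog mdeg (b - a) g else 0.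
Proof.
move=> hf; rewrite [g](@pihomog_partitionE _ _ mdeg (mmeasure mdeg g)) //.
rewrite mulr_sumr !linear_sum /= mulr_sumr.
case: leqP => [leab|ltba].
  apply: eq_bigr => d _; have hd := pihomogP mdeg d g.
  have [edb|ndb] := eqVneq (val d) (b - a)%N.
    rewrite -edb pihomog_id pihomog_dE //.
    by rewrite -(subnKC leab) -edb; exact: dhomogM.
  rewrite [pihomog _ (b - a) _](pihomog_ne0 ndb hd) mulr0.
  apply: (pihomog_ne0 _ (dhomogM hf hd)).
  by apply: contraNneq ndb => <-; rewrite addKn.
apply: big1 => d _; apply: (pihomog_ne0 _ (dhomogM hf (pihomogP mdeg d g))).
by rewrite gtn_eqF // ltn_addr.
Qed.

Lemma annP b (nu : DP b) (f : P) :
  reflect (forall g : P, nu (hcomp b (f * g)) = 0) (ann nu f).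
Proof.
rewrite /ann; apply: (iffP (asboolP _)) => [f0 g|f0 a].
  have -> : hcomp b (f * g) =
      \sum_(a < mmeasure mdeg f) hcomp b (val (hcomp a f) * g).
    apply/val_inj => /=; rewrite raddf_sum /=.
    rewrite {1}[f](@pihomog_partitionE _ _ mdeg (mmeasure mdeg f)) //.
    by rewrite mulr_suml linear_sum.
  rewrite linear_sum; apply: big1 => a _; case: (leqP a b) => [leab|ltba].
    have := congr1 (fun h : DP _ => h (hcomp (b - a) g)) (f0 a).
    rewrite contrE lfunE /= => <-; congr (nu _); apply/val_inj => /=.
    by rewrite !(pihomogMl _ _ (pihomogP mdeg a f)) pihomog_id.
  rewrite (_ : hcomp b _ = 0) ?linear0 //; apply/val_inj => /=.
  by rewrite (pihomogMl _ _ (pihomogP mdeg a f)) leqNgt ltba.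
apply/lfunP => u; rewrite contrE [RHS]lfunE /=.
case: (leqP a b) => [leab|ltba].
  rewrite -[RHS](f0 (val u)); congr (nu _); apply/val_inj => /=.
  rewrite ![_ * val u]mulrC !(pihomogMl _ _ (valP u)) leq_subr subKn //.
  by rewrite pihomog_id.
rewrite (_ : hcomp b _ = 0) ?linear0 //; apply/val_inj => /=.
by rewrite (pihomogMl _ _ (pihomogP mdeg a f)) leqNgt ltba.
Qed.

Lemma ann_submod_closed b (nu : DP b) : submod_closed (ann nu).
Proof.
split=> [|c f g /annP hf /annP hg]; apply/annP => h.
  rewrite mul0r (_ : hcomp b 0 = 0) ?linear0 //.
  by apply/val_inj; rewrite /= linear0.
rewrite (_ : hcomp b _ = hcomp b (f * (c * h)) + hcomp b (g * h)).
  by rewrite linearD /= hf hg addr0.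
apply/val_inj => /=; rewrite -linearD /= mulrDl; congr (pihomog _ _ (_ + _)).
by rewrite mulrCA mulrA.
Qed.

HB.instance Definition _ b (nu : DP b) :=
  GRing.isSubmodClosed.Build P P^o (ann nu) (ann_submod_closed nu).

Definition Ann b (nu : DP b) : submodClosed P^o :=
  GRing.SubmodClosed.clone P P^o (ann nu) _.

(** The degree [i] component of [P / I], for [I] homogeneous. *)
Definition graded (I : submodClosed P^o) (i : nat) (q : quo I) : Prop :=
  exists u : Sym i, q = qpi I (val u).

(** Maximal rank means injective or surjective. *)
Definition weak_lefschetz (I : submodClosed P^o) (l : Sym 1) : Prop :=
  forall i,
    (forall q : quo I, graded i q -> val l *: q = 0 -> q = 0) \/
    (forall r : quo I, graded i.+1 r ->
       exists2 q : quo I, graded i q & r = val l *: q).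

Section Lefschetz.
Variables (U : vectType k) (hU : \dim {:U} = n.+1).

(** Coordinates on [U] identify [Sym U] with [P] and [U] with [Sym 1]. *)
Definition lin (u : U) : Sym 1 :=
  hcomp 1 (\sum_(i < n.+1) coord (tcast hU (vbasis {:U})) i u *: 'X_i).

Lemma lin_linear : linear lin.
Proof.
move=> c v w; apply/val_inj; rewrite /= -linearP; congr (pihomog _ _ _).
rewrite scaler_sumr -big_split; apply: eq_bigr => i _ /=.
by rewrite linearP scalerDl scalerA.
Qed.

Variables (Phi : DP 3) (x : U).

Definition pmap : 'Hom(U, DP 1) :=
  linfun (fun u => contr (lin u) (contr (lin x) Phi) : DP 1).

Lemma pmapE u : pmap u = contr (lin u) (contr (lin x) Phi).
Proof.
have lin_f : linear (fun u => contr (lin u) (contr (lin x) Phi) : DP 1).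
  by move=> c v w; rewrite lin_linear contr_linear.
pose F := GRing.isLinear.Build k _ _ _ _ lin_f.
pose f : {linear U -> DP 1} := HB.pack
  (fun u => contr (lin u) (contr (lin x) Phi) : DP 1) F.
exact: (lfunE f).
Qed.

Definition sq (u v : U) : Sym 2 := mulS (lin u) (lin v).

(** The library's [pmap^-1] is the inverse of [pmap] when [pmap] is
    bijective; [D_0 U^*] is identified with [k] by evaluation at [1]. *)
Definition pairing (u u' : Sym 2) : k :=
  (contr (mulS u (lin ((pmap^-1)%VF (contr u' Phi)))) Phi : DP 0) (hcomp 0 1).

Definition SM (y z w : U) : 'M[k]_3 :=
  let b u1 u2 v1 v2 := pairing (sq u1 u2) (sq v1 v2) in
  let rows :=
    [:: [:: b z z w w - b z w z w; b z w y w - b y z w w; b y z z w - b z z y w];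
        [:: b y w z w - b y z w w; b y y w w - b y w y w; b y z y w - b y y z w];
        [:: b y z z w - b y w z z; b y w y z - b y y z w; b y y z z - b y z y z]]
  in \matrix_(i, j) nth 0 (nth [::] rows i) j.

End Lefschetz.

End Macaulay.

(* Main.v *)
(** The form [Q(u, t) = Phi (x u t)] on [U] is nondegenerate, so [e_a e_b = x v_ab]
    modulo [K = ann Phi] for unique linear forms [v_ab], where [e_1, e_2, e_3] is
    a basis of [U_0].  Let [v_a] be the operator [t |-> v_(a t)] on [U].
    The matrix SM is, up to sign, the curvature [Q([v_b, v_c] e_d, e_g)] of this
    product.  If its leading minor [D] of order two vanished in every basis of
    [U_0], its adjugate would vanish; so in a suitable basis [D] is nonzero and
    the third row and column of SM are zero off the diagonal.

    The five quadrics [e_a e_b - x v_ab - c_ab (e_3^2 - x v_33)], with [c_ab]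
    proportional to the cofactors of SM, are then, up to the factor [-D], the
    Pfaffians of an explicit alternating matrix of linear forms: the coefficients
    match by the definition of the curvature (Gauss equations) and the Jacobi
    identity for the [v_a] (Codazzi equations).  Let [J] be their ideal and
    [q = e_3^2 - x v_33].  Since [D] is nonzero, [K = J + (q)].  The sequence
    [x^4, e_1^4, e_2^4, q] is regular and these fourth powers lie in [K], so [J]
    contains a regular sequence of length three that stays regular modulo [q].
    Hence the Pfaffian complex resolves [P/J], it is self-dual, so that
    [Ext^3(P/J, P)] is [P/J], and [q] is regular on [P/J]: multiplication by [q]
    is the required embedding. *)

Require Import Defs.
From HB Require Import structures.
From mathcomp Require Import all_boot all_algebra.
From mathcomp Require Import ring boolp.
Set Implicit Arguments.
Unset Strict Implicit.
Unset Printing Implicit Defensive.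
Import GRing.Theory.
Local Open Scope ring_scope.

(** Exactness and the regularity of [q] on [P/J] are obtained without depth or dimension theory:
    each Pfaffian acts null-homotopically on the Pfaffian complex, hence so does all of [J], and a
    regular sequence of three such elements forces acyclicity in positive degrees. The argument is
    run modulo an arbitrary ideal: zero gives the resolution, [(q)] gives [Tor_1(P/J, P/q) = 0].

    That fourth powers lie in [K] is clear, [Phi] being cubic; what must be shown is that they lie
    in [J + (q)]. Modulo [J + (q)] a form of degree [d + 1] is [x^d] times a linear form. Since [P]
    is commutative, [x^2 [v_b, v_c] e_d] vanishes there; as [D] is a unit, this kills [x^2 u] for
    [u] in the [Q]-orthogonal of [x], and then [x^3 u] for every [u]. The same reduction gives
    [K = J + (q)] degree by degree.

    No step divides by two: alternating identities carry their diagonal parts, and the off-diagonal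
    cofactors, which vanish at first only up to a factor two, are dealt with through the determinant
    of the adjugate. *)

(** * Ideals as predicates, regular chains, acyclicity of complexes *)

Section RegularChains.
Variable R : comNzRingType.
Implicit Types (I : R -> Prop) (s : seq R) (a f g : R).

(** Predicates in [Prop] rather than [submodClosed]: [adjoin] and [gen] then need no boolean
    membership, and any ideal can be the base of a regular chain. *)
Record ideal I : Prop := Ideal {
  ideal0 : I 0;
  idealD : forall f g, I f -> I g -> I (f + g);
  idealM : forall a f, I f -> I (a * f)
}.

Lemma idealN I f : ideal I -> I f -> I (- f).
Proof. by move=> hI If; rewrite -mulN1r; exact: (idealM hI). Qed.

Lemma idealB I f g : ideal I -> I f -> I g -> I (f - g).
Proof. by move=> hI If Ig; apply: (idealD hI) => //; exact: (idealN hI). Qed.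

Lemma ideal_mulr I a f : ideal I -> I f -> I (f * a).
Proof. by move=> hI If; rewrite mulrC; exact: (idealM hI). Qed.

Lemma ideal_sum I (T : Type) (r : seq T) (P : pred T) (F : T -> R) :
  ideal I -> (forall i, P i -> I (F i)) -> I (\sum_(i <- r | P i) F i).
Proof.
by move=> hI IF; apply: (big_ind I) => //; [exact: (ideal0 hI)|exact: (idealD hI)].
Qed.

Definition adjoin I a f : Prop := exists c, I (f - a * c).

Lemma adjoin_ideal I a : ideal I -> ideal (adjoin I a).
Proof.
move=> hI; split=> [|f g [c Ic] [d Id]|b f [c Ic]].
- by exists 0; rewrite mulr0 subr0; exact: (ideal0 hI).
- exists (c + d); rewrite (_ : _ - _ = (f - a * c) + (g - a * d)); last by ring.
  exact: (idealD hI).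
- exists (b * c); rewrite (_ : _ - _ = b * (f - a * c)); last by ring.
  exact: (idealM hI).
Qed.

Lemma sub_adjoin I a f : I f -> adjoin I a f.
Proof. by exists 0; rewrite mulr0 subr0. Qed.

Lemma mem_adjoin I a b : ideal I -> adjoin I a (a * b).
Proof. by move=> hI; exists b; rewrite subrr; exact: (ideal0 hI). Qed.

Definition nzdiv I a : Prop := forall f, I (a * f) -> I f.

(** Regularity over an arbitrary base ideal, peeled from the head, so that inductions can replace
    [I] by [adjoin I a]. Properness of the final ideal is not included and is handled separately. *)
Fixpoint reg_chain I s : Prop :=
  if s is a :: s' then nzdiv I a /\ reg_chain (adjoin I a) s' else True.

Definition extend I s f : Prop := foldl adjoin I s f.

Lemma extend_rcons I s a : extend I (rcons s a) = adjoin (extend I s) a.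
Proof. by rewrite /extend -cats1 foldl_cat. Qed.

Lemma genP s f : gen s f <-> extend (fun g => g = 0) s f.
Proof.
elim/last_ind: s f => [|s a IHs] f.
  split=> [[c ->]|->]; first by rewrite /extend /= big_ord0.
  by exists (fun=> 0); rewrite big_ord0.
rewrite extend_rcons; split=> [[c]|[d]].
  rewrite size_rcons big_ord_recr /= nth_rcons ltnn eqxx => ->.
  exists (c (size s)); rewrite [a * _]mulrC addrK; apply/IHs; exists c.
  by apply: eq_bigr => i _; rewrite nth_rcons ltn_ord.
move=> /IHs[c hc]; exists (fun i => if i == size s then d else c i).
rewrite size_rcons big_ord_recr /= nth_rcons ltnn !eqxx [d * a]mulrC.
apply/eqP; rewrite -subr_eq hc; apply/eqP; apply: eq_bigr => i _.
by rewrite nth_rcons ltn_ord ltn_eqF.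
Qed.

Lemma reg_chain_rcons I s a :
  reg_chain I (rcons s a) <-> reg_chain I s /\ nzdiv (extend I s) a.
Proof. by elim: s I => [|b s IHs] I /=; [tauto|rewrite IHs; tauto]. Qed.

Lemma reg_chain_genP s : reg_chain (fun g => g = 0) s <->
  forall i, (i < size s)%N -> forall f, gen (take i s) (s`_i * f) -> gen (take i s) f.
Proof.
elim/last_ind: s => [|s a IHs]; first by [].
rewrite reg_chain_rcons IHs size_rcons; split=> [[hs ha] i|hs].
  rewrite ltnS leq_eqVlt => /predU1P[->|lti] f.
    by rewrite nth_rcons ltnn eqxx -cats1 takel_cat // take_size !genP; exact: ha.
  by rewrite nth_rcons lti -cats1 takel_cat 1?ltnW //; exact: hs.
split=> [i lti f|f].
  by have := hs i (ltnW lti) f; rewrite nth_rcons lti -cats1 takel_cat 1?ltnW.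
have := hs (size s) (ltnSn _) f.
by rewrite nth_rcons ltnn eqxx -cats1 takel_cat // take_size !genP.
Qed.

Lemma extend_ideal I s : ideal I -> ideal (extend I s).
Proof. by elim: s I => //= a s IHs I hI; apply: IHs; exact: adjoin_ideal. Qed.

Lemma gen_ideal s : ideal (gen s).
Proof.
have hI : ideal (extend (fun g => g = 0) s).
  apply: extend_ideal; split=> // [f g -> ->|a f ->]; first by rewrite addr0.
  by rewrite mulr0.
split=> [|f g|a f]; rewrite !genP; [exact: (ideal0 hI)|exact: (idealD hI)|exact: (idealM hI)].
Qed.

Lemma gen_mem s f : f \in s -> gen s f.
Proof.
move=> /(nthP 0)[i lti <-]; exists (fun j => (j == i)%:R).
rewrite (bigD1 (Ordinal lti)) //= eqxx mul1r big1 ?addr0 // => j ne.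
by case: eqP => [eji|]; [case/eqP: ne; apply: val_inj|rewrite mul0r].
Qed.

Lemma gen_sub I s f : ideal I -> (forall a, a \in s -> I a) -> gen s f -> I f.
Proof.
move=> hI hs [c ->]; apply: (ideal_sum _ hI) => i _; apply: (idealM hI) => //.
by apply: hs; exact: mem_nth.
Qed.

Lemma eq_reg_chain I I' s : (forall f, I f <-> I' f) ->
  reg_chain I s -> reg_chain I' s.
Proof.
elim: s I I' => //= a s IHs I I' eqI [ha hs]; split.
  by move=> f /eqI/ha/eqI.
by apply: IHs hs => f; split=> -[c] /eqI; exists c.
Qed.

Lemma eq_adjoin I I' a : (forall f, I f <-> I' f) ->
  forall f, adjoin I a f <-> adjoin I' a f.
Proof. by move=> eqI f; split=> -[c] /eqI; exists c. Qed.

Definition mxin I m n (A : 'M[R]_(m, n)) : Prop := forall i j, I (A i j).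

Section Complex.
Variables (n : nat -> nat) (D : forall i, 'M[R]_(n i.+1, n i)).

Definition cycle_mod I i : 'rV[R]_(n i) -> Prop :=
  if i is j.+1 then fun v => mxin I (v *m D j) else fun _ => True.

(** Multiplication by [a] on the complex of row vectors is homotopic to zero. The first equation is
    the one in degree zero, from which no differential leaves; it says in particular that [a] kills
    the cokernel of [D 0]. *)
Definition null_homotopic a : Prop :=
  exists H : forall i, 'M[R]_(n i, n i.+1),
    a%:M = H 0%N *m D 0%N /\
    forall i, a%:M = H i.+1 *m D i.+1 + D i *m H i.

Lemma mxinD I p q (A B : 'M[R]_(p, q)) :
  ideal I -> mxin I A -> mxin I B -> mxin I (A + B).
Proof. by move=> hI hA hB i j; rewrite mxE; exact: (idealD hI). Qed.

Lemma mxinMl I p q r (A : 'M[R]_(p, q)) (B : 'M_(q, r)) :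
  ideal I -> mxin I A -> mxin I (A *m B).
Proof.
move=> hI hA i j; rewrite mxE; apply: (ideal_sum _ hI) => l _; rewrite mulrC.
exact: (idealM hI).
Qed.

Lemma mxin_adjoin I a p q (A : 'M[R]_(p, q)) :
  mxin (adjoin I a) A -> exists C, mxin I (A - a *: C).
Proof.
move=> hA; pose c i j := sval (cid (hA i j)); exists (\matrix_(i, j) c i j).
by move=> i j; rewrite !mxE; exact: (svalP (cid (hA i j))).
Qed.

(* Descending induction on the length of the chain, as in the proof that the
   grade of [J] is computed by the vanishing of [Ext]: if [a] is
   null-homotopic, then [a] times a cycle modulo [I] is a boundary [w D], and
   [w] is a cycle modulo [(I, a)] one degree higher. *)
Lemma chain_acyclic N s :
  (forall i, (N < i)%N -> n i = 0%N) -> (forall i, D i.+1 *m D i = 0) ->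
  (forall a, a \in s -> null_homotopic a) ->
  forall I, ideal I -> reg_chain I s ->
  forall i (v : 'rV[R]_(n i)), (N < i + size s)%N -> cycle_mod I v ->
  exists w, mxin I (v - w *m D i).
Proof.
move=> hN DD; elim: s => [|a s IHs] hs I hI /=.
  move=> _ i v; rewrite addn0 => /hN ni0 _; exists 0 => i' j.
  by have := ltn_ord j; rewrite [X in (_ < X)%N]ni0.
case=> ha hI' i v ltN hv.
have [H [H0 HS]] := hs a (mem_head _ _).
have av : mxin I (a *: v - (v *m H i) *m D i).
  case: i v hv {ltN} => [|i] v hv.
    by rewrite -mulmxA -H0 mul_mx_scalar subrr => i j; rewrite mxE; exact: (ideal0 hI).
  rewrite -mul_mx_scalar HS mulmxDr !mulmxA addrC addrA addNr add0r.
  exact: mxinMl.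
have [||z hz] := IHs (fun b bs => hs b (mem_behead (s := a :: s) bs)) _
    (adjoin_ideal a hI) hI' i.+1 (v *m H i); first by rewrite addSnnS.
  move=> u l; exists (v u l).
  rewrite (_ : _ - _ = - (a *: v - v *m H i *m D i) u l); first exact: (idealN hI).
  by rewrite [in RHS]mxE [in RHS]mxE [(- _ : 'M_(_, _)) _ _]mxE opprB.
have [w hw] := mxin_adjoin hz; exists w => u l; apply: ha.
pose B := a *: v - v *m H i *m D i + (v *m H i - z *m D i.+1 - a *: w) *m D i.
have -> : a * (v - w *m D i) u l = B u l.
  suff -> : B = a *: (v - w *m D i) by rewrite [in RHS]mxE.
  rewrite /B !mulmxBl -scalemxAl -(mulmxA z) DD mulmx0 subr0.
  by rewrite scalerBr addrA subrK.
by apply: (mxinD hI) => //; exact: mxinMl.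
Qed.
End Complex.
End RegularChains.

Section NullHomotopic.
Variables (R : comNzRingType) (n : nat -> nat).
Variable D : forall i, 'M[R]_(n i.+1, n i).

Lemma null_homotopic_ideal : ideal (null_homotopic D).
Proof.
split=> [|f g [F [F0 FS]] [G [G0 GS]]|a f [F [F0 FS]]].
- by exists (fun=> 0); split=> [|i]; rewrite raddf0 !mul0mx ?mulmx0 ?addr0.
- exists (fun i => F i + G i); split=> [|i]; rewrite raddfD /=.
    by rewrite mulmxDl F0 G0.
  by rewrite FS GS mulmxDl mulmxDr addrACA.
- exists (fun i => a *: F i); split=> [|i]; rewrite -scale_scalar_mx.
    by rewrite F0 scalemxAl.
  by rewrite FS scalerDr scalemxAl scalemxAr.
Qed.

End NullHomotopic.

(** * The Pfaffian complex of a 5 by 5 alternating matrix *)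

Section PfaffianComplex.
Variables (R : comNzRingType) (m12 m13 m14 m15 m23 m24 m25 m34 m35 m45 : R).

(** The i-th entry is the Pfaffian of the block of [pfM] obtained by deleting row and column i; the
    alternating signs are those for which [pfM *m pf_col] vanishes. *)
Definition pf : seq R :=
  [:: m23 * m45 - m24 * m35 + m25 * m34;
      - (m13 * m45 - m14 * m35 + m15 * m34);
      m12 * m45 - m14 * m25 + m15 * m24;
      - (m12 * m35 - m13 * m25 + m15 * m23);
      m12 * m34 - m13 * m24 + m14 * m23].

Definition mx5 (rows : seq (seq R)) : 'M[R]_5 :=
  \matrix_(i, j) nth 0 (nth [::] rows i) j.

Definition pfM : 'M[R]_5 := mx5
  [:: [:: 0; m12; m13; m14; m15];
      [:: - m12; 0; m23; m24; m25];
      [:: - m13; - m23; 0; m34; m35];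
      [:: - m14; - m24; - m34; 0; m45];
      [:: - m15; - m25; - m35; - m45; 0]].

Definition pf_col : 'cV[R]_5 := \col_i pf`_i.

Definition pf_rank (i : nat) : nat :=
  match i with 0 => 1 | 1 => 5 | 2 => 5 | 3 => 1 | _ => 0 end%N.

Definition pf_diff (i : nat) : 'M[R]_(pf_rank i.+1, pf_rank i) :=
  match i return 'M[R]_(pf_rank i.+1, pf_rank i) with
  | 0%N => pf_col
  | 1%N => pfM
  | 2%N => pf_col^T
  | _.+3 => 0
  end.

(** The dual of the 4 by 4 alternating block left after deleting row and column [i] of [pfM], padded
    by zeros: its entries are the complementary ones up to sign, so that its product with the block
    is the Pfaffian times the identity. *)
Definition pf_star (i : nat) : 'M[R]_5 := mx5 (nth [::]
  [:: [:: [:: 0; 0; 0; 0; 0];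
       [:: 0; 0; - m45; m35; - m34];
       [:: 0; m45; 0; - m25; m24];
       [:: 0; - m35; m25; 0; - m23];
       [:: 0; m34; - m24; m23; 0]];
      [:: [:: 0; 0; m45; - m35; m34];
       [:: 0; 0; 0; 0; 0];
       [:: - m45; 0; 0; m15; - m14];
       [:: m35; 0; - m15; 0; m13];
       [:: - m34; 0; m14; - m13; 0]];
      [:: [:: 0; - m45; 0; m25; - m24];
       [:: m45; 0; 0; - m15; m14];
       [:: 0; 0; 0; 0; 0];
       [:: - m25; m15; 0; 0; - m12];
       [:: m24; - m14; 0; m12; 0]];
      [:: [:: 0; m35; - m25; 0; m23];
       [:: - m35; 0; m15; 0; - m13];
       [:: m25; - m15; 0; 0; m12];
       [:: 0; 0; 0; 0; 0];
       [:: - m23; m13; - m12; 0; 0]];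
      [:: [:: 0; - m34; m24; - m23; 0];
       [:: m34; 0; - m14; m13; 0];
       [:: - m24; m14; 0; - m12; 0];
       [:: m23; - m13; m12; 0; 0];
       [:: 0; 0; 0; 0; 0]]] i).

Lemma mulmx5E p q (A : 'M[R]_(p, 5)) (B : 'M_(5, q)) i j : (A *m B) i j =
  A i 0 * B 0 j + A i 1 * B 1 j + A i 2%:R * B 2%:R j + A i 3%:R * B 3%:R j
  + A i 4%:R * B 4%:R j.
Proof.
rewrite mxE !big_ord_recl big_ord0 addr0 !addrA.
by do ![congr (_ + _)]; congr (A _ _ * B _ _); apply: val_inj.
Qed.

Lemma ord5P (P : 'I_5 -> Prop) :
  P 0 -> P 1 -> P 2%:R -> P 3%:R -> P 4%:R -> forall i, P i.
Proof.
move=> P0 P1 P2 P3 P4 [[|[|[|[|[|//]]]]] lti].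
- by rewrite (_ : Ordinal lti = 0) //; apply: val_inj.
- by rewrite (_ : Ordinal lti = 1) //; apply: val_inj.
- by rewrite (_ : Ordinal lti = 2%:R) //; apply: val_inj.
- by rewrite (_ : Ordinal lti = 3%:R) //; apply: val_inj.
- by rewrite (_ : Ordinal lti = 4%:R) //; apply: val_inj.
Qed.

Lemma pfM_col : pfM *m pf_col = 0.
Proof.
apply/matrixP=> i j; rewrite mulmx5E !mxE.
by elim/ord5P: i => /=; ring.
Qed.

Lemma tr_pfM : pfM^T = - pfM.
Proof.
by apply/matrixP=> i j; rewrite !mxE; elim/ord5P: i; elim/ord5P: j => /=; ring.
Qed.

Lemma pf_star_mul (i : 'I_5) :
  (pf`_i)%:M = pf_star i *m pfM + pf_col *m delta_mx 0 i.
Proof.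
apply/matrixP=> j l; rewrite [RHS]mxE mulmx5E ![(_ *m delta_mx _ _) _ _]mxE.
rewrite big_ord_recl big_ord0 addr0 !mxE.
by elim/ord5P: i; elim/ord5P: j; elim/ord5P: l => /=; ring.
Qed.

Lemma tr_pf_star (i : 'I_5) : (pf_star i)^T = - pf_star i.
Proof.
by apply/matrixP=> j l; rewrite !mxE; elim/ord5P: i; elim/ord5P: j; elim/ord5P: l => /=; ring.
Qed.

Lemma pf_diff_complex i : pf_diff i.+1 *m pf_diff i = 0.
Proof.
case: i => [|[|[|i]]] /=; rewrite ?mul0mx ?mulmx0 //; first exact: pfM_col.
by apply: (can_inj (@trmxK _ _ _)); rewrite trmx_mul trmxK tr_pfM mulNmx pfM_col oppr0 trmx0.
Qed.

(** The homotopy for the i-th Pfaffian consists of the i-th unit row, [pf_star i] and the i-th unit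
    column; the unit vectors pick this Pfaffian out of the two outer differentials. *)
Lemma pf_null_homotopic a : gen pf a -> null_homotopic pf_diff a.
Proof.
apply: gen_sub; first exact: null_homotopic_ideal.
move=> f /(nthP 0)[i lti <-] {f}; pose i5 : 'I_5 := Ordinal lti.
pose H j : 'M[R]_(pf_rank j, pf_rank j.+1) :=
  match j return 'M[R]_(pf_rank j, pf_rank j.+1) with
  | 0%N => delta_mx 0 i5
  | 1%N => pf_star i5
  | 2%N => delta_mx i5 0
  | _.+3 => 0
  end.
exists H; split=> [|[|[|[|j]]]] /=.
- by apply/matrixP=> u v; rewrite !ord1 -rowE !mxE eqxx.
- exact: (pf_star_mul i5).
(* The identity in degree two is the transpose of the one in degree one, since both [pfM] and
   [pf_star] change sign under transposition. *)
- apply: (can_inj (@trmxK _ _ _)); rewrite tr_scalar_mx (pf_star_mul i5) addrC.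
  rewrite linearD /= !trmx_mul trmxK tr_pfM (tr_pf_star i5) mulmxN mulNmx opprK trmx_delta.
  by [].
- rewrite mulmx0 add0r; apply/matrixP=> u v; rewrite !ord1 -colE !mxE eqxx.
  by [].
- by apply/matrixP=> -[].
Qed.

End PfaffianComplex.

(** * Lifting along non-surjective maps and comparison of resolutions *)

Lemma linear_of (R : comNzRingType) (A B : lmodType R) (f : A -> B) :
  linear f -> exists g : {linear A -> B}, g =1 f.
Proof.
move=> lin_f; pose F := GRing.isLinear.Build R A B _ f lin_f.
by exists (HB.pack_for {linear A -> B} f F).
Qed.

Section ImageModule.
Variables (R : comNzRingType) (A B : lmodType R) (g : {linear A -> B}).

Definition in_image (b : B) : bool := `[< exists a, g a = b >].

Lemma in_image_submod_closed : submod_closed in_image.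
Proof.
split=> [|c u v /asboolP[a <-] /asboolP[b <-]]; apply/asboolP.
  by exists 0; rewrite linear0.
by exists (c *: a + b); rewrite linearP.
Qed.

HB.instance Definition _ :=
  GRing.isSubmodClosed.Build R B in_image in_image_submod_closed.

Definition image_mod : Type := {b : B | in_image b}.

HB.instance Definition _ := SubChoice.on image_mod.
HB.instance Definition _ := [SubChoice_isSubLmodule of image_mod by <:].

(** [projective] lifts along surjections only; here [g] need not be onto, so both maps are
    corestricted to [image_mod]. *)
Lemma projective_lift (P : lmodType R) (f : {linear P -> B}) : projective P ->
  (forall p, exists a, g a = f p) ->
  exists h : {linear P -> A}, forall p, g (h p) = f p.
Proof.
move=> projP fg.
have fP p : in_image (f p) by apply/asboolP; exact: fg.
have gP a : in_image (g a) by apply/asboolP; exists a.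
have [|f' f'E] := @linear_of R P image_mod (fun p => exist _ (f p) (fP p)).
  by move=> c u v; apply: val_inj; rewrite /= linearP.
have [|g' g'E] := @linear_of R A image_mod (fun a => exist _ (g a) (gP a)).
  by move=> c u v; apply: val_inj; rewrite /= linearP.
have [|h hE] := projP A image_mod g' f'.
  move=> [b bP]; have [a ab] := asboolP _ bP; exists a.
  by rewrite g'E; apply: val_inj.
by exists h => p; have := congr1 val (hE p); rewrite f'E g'E.
Qed.

End ImageModule.

Lemma rV_projective (R : comNzRingType) n : projective 'rV[R]_n.
Proof.
move=> N N' s f surj_s.
pose c i := sval (cid (surj_s (f (delta_mx 0 i)))).
have [|h hE] := @linear_of R 'rV_n N (fun v => \sum_i v 0 i *: c i).
  move=> a u v; rewrite scaler_sumr -big_split; apply: eq_bigr => i _ /=.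
  by rewrite !mxE scalerDl scalerA.
exists h => v; rewrite hE linear_sum [in RHS](row_sum_delta v) linear_sum.
apply: eq_bigr => i _; rewrite !linearZ /=; congr (_ *: _).
exact: (svalP (cid (surj_s (f (delta_mx 0 i))))).
Qed.

Section Comparison.
Variables (R : comNzRingType) (M : lmodType R).

(** Degrees up to two are enough, because the only competitors to be excluded are resolutions of
    length at most two. *)
Lemma chain_map (F G : resolution M) :
  exists (a0 : {linear F 0%N -> G 0%N}) (a1 : {linear F 1%N -> G 1%N})
         (a2 : {linear F 2%N -> G 2%N}),
    [/\ forall v, aug G (a0 v) = aug F v,
        forall v, diff G 0 (a1 v) = a0 (diff F 0 v) &
        forall v, diff G 1 (a2 v) = a1 (diff F 1 v)].
Proof.
have [a0 a0E] := projective_lift (g := aug G) (f := aug F) (@term_proj _ _ F 0)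
  (fun p => @aug_surj _ _ G _).
have [|a1 a1E] := projective_lift (g := diff G 0) (f := a0 \o diff F 0) (@term_proj _ _ F 1).
  by move=> v; apply/aug_exact; rewrite /= a0E; apply/aug_exact; exists v.
have [|a2 a2E] := projective_lift (g := diff G 1) (f := a1 \o diff F 1) (@term_proj _ _ F 2).
  move=> v; apply/diff_exact; rewrite /= a1E /=.
  by rewrite (_ : diff F 0 _ = 0) ?linear0 //; apply/diff_exact; exists v.
by exists a0, a1, a2.
Qed.

Lemma chain_homotopy (F : resolution M) (c0 : {linear F 0%N -> F 0%N})
    (c1 : {linear F 1%N -> F 1%N}) (c2 : {linear F 2%N -> F 2%N}) :
  (forall v, aug F (c0 v) = 0) ->
  (forall v, diff F 0 (c1 v) = c0 (diff F 0 v)) ->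
  (forall v, diff F 1 (c2 v) = c1 (diff F 1 v)) ->
  exists (h1 : {linear F 1%N -> F 2%N}) (h2 : {linear F 2%N -> F 3%N}),
    forall v, c2 v = diff F 2 (h2 v) + h1 (diff F 1 v).
Proof.
move=> c0E c1E c2E.
have [|h0 h0E] := projective_lift (g := diff F 0) (f := c0) (@term_proj _ _ F 0).
  by move=> v; apply/aug_exact.
have [|h1 h1E] := projective_lift (g := diff F 1)
    (f := (c1 \- (h0 \o diff F 0))) (@term_proj _ _ F 1).
  by move=> v; apply/(@diff_exact _ _ F 0); rewrite /= linearB /= c1E h0E subrr.
have [|h2 h2E] := projective_lift (g := diff F 2)
    (f := (c2 \- (h1 \o diff F 1))) (@term_proj _ _ F 2).
  move=> v; apply/(@diff_exact _ _ F 1); rewrite /= linearB /= c2E h1E /=.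
  rewrite subKr (_ : diff F 0 _ = 0) ?linear0 //; apply/(@diff_exact _ _ F 0).
  by exists v.
by exists h1, h2 => v; rewrite h2E /= subrK.
Qed.

(* Compare [F] with a resolution of length at most two and read off the
   homotopy to the identity in degree three. *)
Lemma pd_le2_split (F : resolution M) m : (m <= 2)%N -> pd_le M m ->
  (forall v, diff F 2 v = 0 -> v = 0) ->
  exists h : {linear F 2%N -> F 3%N}, forall v, h (diff F 2 v) = v.
Proof.
move=> le_m2 [G G0] inj.
have [a0 [a1 [a2 [a0E a1E a2E]]]] := chain_map F G.
have [b0 [b1 [b2 [b0E b1E b2E]]]] := chain_map G F.
have [|||h1 [h2 hE]] := @chain_homotopy F (idfun \- (b0 \o a0)) (idfun \- (b1 \o a1))
    (idfun \- (b2 \o a2)).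
- by move=> v; rewrite /= linearB /= b0E a0E subrr.
- by move=> v; rewrite /= linearB /= b1E a1E.
- by move=> v; rewrite /= linearB /= b2E a2E.
have dd v : diff F 1 (diff F 2 v) = 0 by apply/diff_exact; exists v.
have a20 v : a2 (diff F 2 v) = 0.
  have [w <-] : exists w, diff G 2 w = a2 (diff F 2 v).
    by apply/(@diff_exact _ _ G 1); rewrite a2E dd linear0.
  by rewrite (G0 3%N le_m2 w) linear0.
exists h2 => v; apply/eqP; rewrite -subr_eq0; apply/eqP; apply: inj.
have := hE (diff F 2 v); rewrite /= dd a20 (linear0 b2) (linear0 h1) oppr0 !addr0 => E.
by rewrite linearB /= -E subrr.
Qed.

End Comparison.

(** * The Pfaffian ideal: resolution, grade, perfection, Ext and the embedding *)

Section GeneratedIdeal.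
Variables (R : comNzRingType) (s : seq R).

Definition in_gen (f : R^o) : bool := `[< gen s f >].

Lemma in_gen_submod_closed : submod_closed in_gen.
Proof.
split=> [|c f g /asboolP hf /asboolP hg]; apply/asboolP.
  exact: (ideal0 (gen_ideal s)).
by apply: (idealD (gen_ideal s)) => //; exact: (idealM (gen_ideal s)).
Qed.

HB.instance Definition _ :=
  GRing.isSubmodClosed.Build R R^o in_gen in_gen_submod_closed.

Definition gen_submod : submodClosed R^o :=
  GRing.SubmodClosed.clone R R^o in_gen _.

Lemma gen_submodP (f : R^o) : reflect (gen s f) (f \in gen_submod).
Proof. exact: asboolP. Qed.

End GeneratedIdeal.

Lemma zero_ideal (R : comNzRingType) : ideal (fun f : R => f = 0).
Proof.
split=> // [f g -> ->|a f ->]; first by rewrite addr0.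
by rewrite mulr0.
Qed.

Section PfaffianResolution.
Variables (R : comNzRingType) (m12 m13 m14 m15 m23 m24 m25 m34 m35 m45 : R).
Local Notation p := (pf m12 m13 m14 m15 m23 m24 m25 m34 m35 m45).
Local Notation D := (pf_diff m12 m13 m14 m15 m23 m24 m25 m34 m35 m45).
Local Notation J := (gen_submod p).

Lemma gen_pfE f : gen p f <-> exists w : 'rV_5, f = (w *m D 0%N) 0 0.
Proof.
split=> [[c ->]|[w ->]].
  exists (\row_i c i); rewrite mxE; apply: eq_bigr => i _.
  by rewrite !mxE.
exists (fun i => w 0 (inord i)); rewrite mxE; apply: eq_bigr => i _.
by rewrite !mxE inord_val.
Qed.

Definition pf_aug (v : 'rV[R]_1) : quo J := qpi J (v 0 0).

Lemma pf_aug_linear : linear pf_aug.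
Proof. by move=> a u v; rewrite /pf_aug !mxE -linearP. Qed.

HB.instance Definition _ :=
  GRing.isLinear.Build R 'rV[R]_1 (quo J) _ pf_aug pf_aug_linear.

Variable s : seq R.
Hypothesis size_s : size s = 3%N.
Hypothesis sJ : forall a, a \in s -> gen p a.

(** The ranks vanish above three and [s] has length three, so [chain_acyclic] covers every positive
    degree. The base ideal stays free for the later use with the ideal of [q]. *)
Lemma pf_acyclic I : ideal I -> reg_chain I s ->
  forall i (v : 'rV_(pf_rank i)), (0 < i)%N ->
  cycle_mod (n := pf_rank) D I v -> exists w, mxin I (v - w *m D i).
Proof.
move=> hI regs i v i_gt0; apply: (chain_acyclic (N := 3) (s := s)) => //.
- by case=> [|[|[|[|]]]].
- exact: pf_diff_complex.
- by move=> a /sJ; exact: pf_null_homotopic.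
by rewrite size_s -[X in (X < _)%N]add0n ltn_add2r.
Qed.

Hypothesis reg_s : reg_chain (fun f : R => f = 0) s.

Lemma pf_exact i (v : 'rV_(pf_rank i.+1)) :
  v *m D i = 0 <-> exists w, w *m D i.+1 = v.
Proof.
split=> [v0|[w <-]]; last by rewrite -mulmxA pf_diff_complex mulmx0.
have [//||w hw] := @pf_acyclic _ (@zero_ideal R) reg_s i.+1 v.
  by move=> j l; rewrite v0 mxE.
exists w; apply/esym/eqP; rewrite -subr_eq0; apply/eqP/matrixP=> j l.
by rewrite hw mxE.
Qed.

Lemma pf_aug_surj (q : quo J) : exists v, pf_aug v = q.
Proof.
have [f ->] := qpi_surj q; exists f%:M.
by rewrite /pf_aug mxE eqxx mulr1n.
Qed.

Lemma pf_aug_exact v : pf_aug v = 0 <-> exists w, w *m D 0%N = v.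
Proof.
rewrite /pf_aug -(linear0 (qpi J)) qpiP subr0; split=> [/gen_submodP|[w <-]].
  move=> /gen_pfE[w hw]; exists w; apply/matrixP=> i j.
  by rewrite !ord1 hw.
by apply/gen_submodP/gen_pfE; exists w.
Qed.

Definition pf_resolution : resolution (quo J) :=
  @Resolution R (quo J) (fun i => 'rV[R]_(pf_rank i) : lmodType R)
    (fun i => mulmxr (D i)) pf_aug (fun i => @rV_projective R (pf_rank i))
    pf_aug_surj pf_aug_exact pf_exact.

Hypothesis J1 : ~ gen p 1.

Lemma pf_diff2_inj (v : 'rV_1) : v *m D 2%N = 0 -> v = 0.
Proof. by move=> /pf_exact[w <-]; rewrite mulmx0. Qed.

(** A resolution of length at most two would split the last differential, which is the row of
    Pfaffians; the splitting, applied to the image of 1, would express 1 through the Pfaffians. *)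
Lemma pd_pf : pd_eq (quo J) 3.
Proof.
split=> [|m hm].
  by exists pf_resolution; case=> [|[|[|[|i]]]] // _ v; apply/matrixP=> j [].
rewrite leqNgt; apply/negP => lt_m3.
have [|h hE] := @pd_le2_split _ _ pf_resolution m lt_m3 hm; first exact: pf_diff2_inj.
case: J1; apply/gen_pfE.
pose e : 'rV[R]_1 := 1%:M.
exists (\row_i (h (delta_mx 0 i) : 'rV_1) 0 0).
have := congr1 (fun v : 'rV_1 => v 0 0) (hE e).
rewrite [RHS]mxE eqxx mulr1n => <-.
rewrite /= [in LHS](row_sum_delta (e *m _)) linear_sum summxE mxE.
apply: eq_bigr => i _; rewrite linearZ mxE mulrC mul1mx !mxE.
by [].
Qed.

(** For the upper bound, a regular sequence of more than three elements of the ideal would extend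
    acyclicity to degree zero, where every vector is a cycle: 1 would be a boundary, hence in the
    ideal. *)
Lemma grade_pf : grade_eq J 3.
Proof.
split=> [|m [t [<- tJ [reg_t _]]]].
  exists s; split=> //; first by move=> a /sJ ?; apply/gen_submodP.
  split; first exact/reg_chain_genP.
  by move=> h; case: J1; apply: gen_sub h; [exact: gen_ideal|exact: sJ].
rewrite leqNgt; apply/negP => lt3; case: J1; apply/gen_pfE.
have [||||||w hw] := @chain_acyclic R pf_rank D 3 t _ _ _ _ (@zero_ideal R) _ 0%N 1%:M.
- by case=> [|[|[|[|]]]].
- exact: pf_diff_complex.
- by move=> a /tJ /gen_submodP; exact: pf_null_homotopic.
- exact/reg_chain_genP.
- by [].
- by [].
exists w; have := hw 0 0; rewrite mxE [(- _ : 'M_(_, _)) _ _]mxE !mxE eqxx mulr1n.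
by move=> /eqP; rewrite subr_eq0 => /eqP.
Qed.

Lemma perfect_pf : perfect J.
Proof.
split; first by apply/negP => /gen_submodP.
by exists 3%N; split; [exact: grade_pf|exact: pd_pf].
Qed.

Variable q : R.
Hypothesis reg_q : nzdiv (fun f : R => f = 0) q.
Hypothesis reg_qs : reg_chain (adjoin (fun f : R => f = 0) q) s.

(* [Tor_1(P/J, P/q) = 0], since [s] stays regular modulo [q]. *)
Lemma nzdiv_pf : nzdiv (gen p) q.
Proof.
move=> f /gen_pfE[w hw]; apply/gen_pfE.
have hI : ideal (adjoin (fun f : R => f = 0) q).
  by apply: adjoin_ideal; exact: zero_ideal.
have [//||z hz] := pf_acyclic hI reg_qs (i := 1) (v := w).
  by move=> i j; rewrite !ord1 -hw; exact: mem_adjoin (zero_ideal R).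
have [u hu] := mxin_adjoin hz.
exists u; apply/eqP; rewrite -subr_eq0; apply/eqP/reg_q.
rewrite mulrBr hw.
have {hu} -> : w = z *m D 1%N + q *: u.
  apply/eqP; rewrite -subr_eq0 opprD addrA; apply/eqP/matrixP=> i j.
  by rewrite [RHS]mxE; exact: hu.
by rewrite mulmxDl -mulmxA pf_diff_complex mulmx0 add0r -scalemxAl [X in _ - X]mulrC mxE mulrC subrr.
Qed.

Variable K : submodClosed R^o.
Hypothesis KE : forall f, f \in K <-> exists c, gen p (f - q * c).

Local Notation F := pf_resolution.
Local Notation e := (1%:M : 'rV[R]_1).

Lemma cocycle_linear (z : cocycles F 3 R^o) (v : 'rV_1) :
  val z v = v 0 0 * val z e.
Proof.
have /asboolP[lin_z _] := valP z; have [g gE] := linear_of lin_z.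
by rewrite -!gE {1}[v]mx11_scalar -(scalemx1 _ (v 0 0)) linearZ.
Qed.

(** Nothing lives in degree four, so a cocycle is any linear map from the last term and amounts to
    its value at [e]. The last differential is the row of Pfaffians, so the coboundaries are the
    values in the Pfaffian ideal: the Ext module is its quotient ring. *)
Lemma coboundaryE (z : cocycles F 3 R^o) :
  coboundary z <-> gen p (val z e).
Proof.
split=> [/asboolP[g ->]|/gen_pfE[w hw]].
  rewrite /= mul1mx; apply/gen_pfE; exists (\row_i (g (delta_mx 0 i) : R)).
  rewrite [in LHS](row_sum_delta (_^T)) linear_sum mxE.
  by apply: eq_bigr => i _; rewrite linearZ !mxE mulrC.
apply/asboolP; pose gf (v : 'rV[R]_5) : R^o := \sum_i v 0 i * w 0 i.
have [|g gE] := @linear_of R 'rV_5 R^o gf.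
  move=> a u v; rewrite scaler_sumr -big_split; apply: eq_bigr => i _ /=.
  by rewrite !mxE mulrDl -mulrA.
exists g; apply/funext => v; rewrite cocycle_linear hw /= gE /gf mxE mulr_sumr.
apply: eq_bigr => i _; rewrite !mxE big_ord_recl big_ord0 addr0 !mxE.
by rewrite -mulrA [w _ _ * _]mulrC.
Qed.

Definition theta0 (z : cocycles F 3 R^o) : quo J := qpi J (q * (val z e : R)).

Lemma theta0_linear : linear theta0.
Proof.
move=> a u v; rewrite /theta0 -linearP; congr (qpi J _) => /=.
by rewrite [in LHS]/GRing.scale /= mulrDr mulrCA.
Qed.

HB.instance Definition _ :=
  GRing.isLinear.Build R (cocycles F 3 R^o) (quo J) _ theta0 theta0_linear.

Lemma theta0_eq0 z : theta0 z = 0 <-> gen p (val z e).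
Proof.
rewrite /theta0 -(linear0 (qpi J)) qpiP subr0; split=> [/gen_submodP/nzdiv_pf//|h].
by apply/gen_submodP; exact: (idealM (gen_ideal p)).
Qed.

Lemma theta_exists : exists theta : {linear Ext F 3 R^o -> quo J},
  injective theta /\ forall z, theta (qpi _ z) = theta0 z.
Proof.
have th z : theta0 (repr (qpi _ z : Ext F 3 R^o)) = theta0 z.
  apply/eqP; rewrite -subr_eq0 -linearB; apply/eqP/theta0_eq0/coboundaryE.
  by apply/qpiP; rewrite {1}/qpi reprK.
have [|t tE] := @linear_of R (Ext F 3 R^o) (quo J) (fun z => theta0 (repr z)).
  move=> a x y; have [u ->] := qpi_surj x; have [v ->] := qpi_surj y.
  by rewrite -linearP !th linearP.
exists t; split=> [|z]; last by rewrite tE th.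
move=> x y; have [u ->] := qpi_surj x; have [v ->] := qpi_surj y.
rewrite !tE !th => /eqP; rewrite -subr_eq0 -linearB => /eqP/theta0_eq0 h.
by apply/qpiP; apply/coboundaryE.
Qed.

Lemma cocycle_exists (c : R) : exists z : cocycles F 3 R^o, val z e = c.
Proof.
pose f (v : F 3) : R^o := (v : 'rV_1) 0 0 * c.
have fP : cocycle f.
  apply/asboolP; split=> [a u v|v]; first by rewrite /f !mxE mulrDl -mulrA.
  by rewrite /f /= mulmx0 mxE mul0r.
by exists (exist _ f fP); rewrite /= /f mxE eqxx mul1r.
Qed.

Hypothesis K1 : (1 : R^o) \notin K.

Lemma pf_section_linked : generalized_linked_sum 3 K.
Proof.
have JK f : gen p f -> f \in K by move=> h; apply/KE; exists 0; rewrite mulr0 subr0.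
have nJ1 : ~ gen p 1 by move=> /JK; apply/negP.
exists J; split.
- exact: perfect_pf.
- exact: grade_pf.
- by move=> f /gen_submodP/JK.
- exists F; have [t [t_inj tE]] := theta_exists; exists t; split=> // x.
  split=> [[z <-]|[f fK ->]].
    have [u ->] := qpi_surj z; rewrite tE; exists (q * (val u e : R)) => //.
    apply/KE; exists (val u e : R); rewrite subrr.
    exact: (ideal0 (gen_ideal p)).
  have [c hc] := (KE f).1 fK; have [z zE] := cocycle_exists c.
  exists (qpi _ z); rewrite tE /theta0 zE; apply/esym/qpiP.
  exact/gen_submodP.
- exists (q :: s); split=> [|f|]; first by rewrite /= size_s.
    rewrite inE => /predU1P[->|/sJ/JK //]; apply/KE; exists 1.
    by rewrite mulr1 subrr; exact: (ideal0 (gen_ideal p)).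
  split; first by apply/reg_chain_genP; split.
  move=> h; case/negP: K1; apply/KE.
  have: adjoin (gen p) q 1.
    apply: gen_sub h; first by apply: adjoin_ideal; exact: gen_ideal.
    move=> f; rewrite inE => /predU1P[->|/sJ]; last exact: sub_adjoin.
    by rewrite -[q in adjoin _ _ q]mulr1; exact: mem_adjoin (gen_ideal p).
  by case=> c; exists c.
Qed.

End PfaffianResolution.

(** * Congruent replacement and permutation in regular chains *)

Section MoreChains.
Variable R : comNzRingType.
Implicit Types (I : R -> Prop) (a b f : R) (s : seq R).

Lemma adjoinC I a b f : adjoin (adjoin I a) b f -> adjoin (adjoin I b) a f.
Proof.
by case=> c [d h]; exists d, c; rewrite (_ : _ - _ = f - b * c - a * d); last by ring.
Qed.

Lemma nzdiv_congr I a b : ideal I -> I (a - b) -> nzdiv I a -> nzdiv I b.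
Proof.
move=> hI Iab ha f Ibf; apply: ha.
rewrite (_ : a * f = f * (a - b) + b * f); last by ring.
by apply: (idealD hI) => //; exact: (idealM hI).
Qed.

Lemma adjoin_congr I a b f : ideal I -> I (a - b) -> adjoin I a f -> adjoin I b f.
Proof.
move=> hI Iab [c h]; exists c.
rewrite (_ : _ - _ = (f - a * c) + c * (a - b)); last by ring.
by apply: (idealD hI) => //; exact: (idealM hI).
Qed.

Lemma reg_chain_congr I s t : ideal I -> size s = size t ->
  (forall i, (i < size s)%N -> I (s`_i - t`_i)) -> reg_chain I s -> reg_chain I t.
Proof.
elim: s t I => [|a s IHs] [|b t] I //= hI [sz] hst [ha hs].
have Iab := hst 0%N isT.
split; first exact: nzdiv_congr ha.
apply: (@eq_reg_chain _ (adjoin I a)).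
  move=> f; split; apply: adjoin_congr => //.
  by rewrite -opprB; exact: idealN.
apply: IHs hs => //; first exact: adjoin_ideal.
by move=> i lti; apply: sub_adjoin; exact: (hst i.+1).
Qed.

End MoreChains.

Section GradedChains.
Variables (k : fieldType) (n : nat).
Local Notation P := {mpoly k[n.+1]}.
Implicit Types (I : P -> Prop) (a b f : P) (s : seq P).

Definition homogeneous I : Prop := forall d f, I f -> I (pihomog mdeg d f).

Definition pos_form f : Prop := exists2 d, (0 < d)%N & f \is d.-homog.

Lemma homogeneous_adjoin I a : ideal I -> homogeneous I -> pos_form a ->
  homogeneous (adjoin I a).
Proof.
move=> hI hom [e e_gt0 ha] d f [c h].
exists (if (e <= d)%N then pihomog mdeg (d - e) c else 0).
have := hom d _ h; rewrite linearB /= (pihomogMl _ _ ha).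
by case: ifP => //; rewrite mulr0.
Qed.

Lemma mem_homogeneous I f : ideal I -> (forall d, I (pihomog mdeg d f)) -> I f.
Proof.
move=> hI h; rewrite [f](@pihomog_partitionE _ _ mdeg (mmeasure mdeg f)) //.
exact: (ideal_sum _ hI).
Qed.

(** Descent on the degree: if [b * f] is in [I], then [f] is a multiple [a * c'] modulo [I], and
    cancelling [a] puts [b * c'] in [I]. The degree of [c'] is smaller because that of [a] is
    positive. *)
Lemma nzdiv_form_swap I a b : ideal I -> homogeneous I -> pos_form a -> pos_form b ->
  nzdiv I a -> nzdiv (adjoin I a) b -> nzdiv I b.
Proof.
move=> hI hom [e e_gt0 ha] [e' _ hb] ra rb.
suff main d f : f \is d.-homog -> I (b * f) -> I f.
  move=> f h; apply: mem_homogeneous => // d; apply: (main d); first exact: pihomogP.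
  by have := hom (d + e')%N _ h; rewrite (pihomogMl _ _ hb) leq_addl addnK.
elim/ltn_ind: d f => d IHd f hf h.
have [c /(hom d)] : adjoin I a f by apply: rb; exact: sub_adjoin.
rewrite linearB /= (pihomog_dE hf) (pihomogMl _ _ ha).
case: leqP => [le_ed|_]; last by rewrite subr0.
have := pihomogP mdeg (d - e) c; move: (pihomog _ _ c) => c' hc' Ifc.
rewrite -[f](subrK (a * c')); apply: (idealD hI) => //; apply: (idealM hI).
apply: (IHd (d - e)%N) => //; first by rewrite ltn_subrL e_gt0 (leq_trans e_gt0).
apply: ra; rewrite (_ : a * _ = b * f - b * (f - a * c')); last by ring.
by apply: (idealB hI) => //; exact: (idealM hI).
Qed.

(** From [a * f = b * c] modulo [I], regularity of [b] modulo [a] gives [c = a * d], and cancelling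
    [a] gives [f = b * d]. *)
Lemma nzdiv_adjoin_swap I a b : ideal I -> nzdiv I a -> nzdiv (adjoin I a) b ->
  nzdiv I b -> nzdiv (adjoin I b) a.
Proof.
move=> hI ra rb rb' f [c h].
have [d hd] : adjoin I a c.
  apply: rb; exists f; rewrite (_ : _ - _ = - (a * f - b * c)); last by ring.
  exact: idealN.
exists d; apply: ra.
rewrite (_ : _ * _ = (a * f - b * c) + b * (c - a * d)); last by ring.
by apply: (idealD hI) => //; exact: (idealM hI).
Qed.

Lemma reg_chain_rot I a s : ideal I -> homogeneous I -> pos_form a ->
  (forall b, b \in s -> pos_form b) -> reg_chain I (a :: s) -> reg_chain I (rcons s a).
Proof.
elim: s I => [|b s IHs] I hI hom fa fs //= [ra [rb rs]].
have fb : pos_form b by apply: fs; rewrite mem_head.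
have rb' : nzdiv I b by apply: nzdiv_form_swap rb.
split=> //; apply: IHs => //; [exact: adjoin_ideal|exact: homogeneous_adjoin| |].
  by move=> c cs; apply: fs; rewrite inE cs orbT.
split; first exact: nzdiv_adjoin_swap rb rb'.
by apply: eq_reg_chain rs => f; split; exact: adjoinC.
Qed.

Lemma reg_chain_rotr I a s : ideal I -> homogeneous I -> pos_form a ->
  (forall b, b \in s -> pos_form b) -> reg_chain I (rcons s a) -> reg_chain I (a :: s).
Proof.
elim: s I => [|b s IHs] I hI hom fa fs //= [rb hs].
have fb : pos_form b by apply: fs; rewrite mem_head.
have fs' c : c \in s -> pos_form c by move=> cs; apply: fs; rewrite inE cs orbT.
have [ra rs] := IHs _ (adjoin_ideal b hI) (homogeneous_adjoin hI hom fb) fa fs' hs.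
have ra' : nzdiv I a by apply: nzdiv_form_swap ra.
do 2?split=> //; first exact: nzdiv_adjoin_swap ra ra'.
by apply: eq_reg_chain rs => f; split; exact: adjoinC.
Qed.

End GradedChains.

(** * Powers of variables, and regular chains congruent to them modulo a quadric *)

Section MonomialChains.
Variables (k : fieldType) (n e : nat).
Local Notation P := {mpoly k[n.+1]}.

(** The ideal of the [e]-th powers of the first [j] variables, described by supports so that
    regularity can be read off from coefficients; [extend_mono_powers] gives the link with
    generators. *)
Definition mono_ideal (j : nat) (f : P) : Prop :=
  forall m, f@_m != 0 -> exists2 i : 'I_n.+1, (i < j)%N & (e <= m i)%N.

Lemma mono_ideal0 f : mono_ideal 0 f <-> f = 0.
Proof.
split=> [h|-> m]; last by rewrite mcoeff0 eqxx.
by apply/mpolyP=> m; rewrite mcoeff0; apply/eqP/negPn/negP => /h[].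
Qed.

Lemma mono_ideal_ideal j : ideal (mono_ideal j).
Proof.
split=> [m|f g hf hg m|a f hf m]; first by rewrite mcoeff0 eqxx.
  rewrite mcoeffD; have [->|/hf //] := eqVneq f@_m 0.
  by rewrite add0r; exact: hg.
rewrite mcoeffM => nz.
have /hasP[[m1 m2] _ /= /andP[/eqP em]] : has (fun mm : 'X_{1..n.+1 < (mdeg m).+1, (mdeg m).+1} =>
    (m == (mm.1 + mm.2)%MM) && (f@_mm.2 != 0)) (index_enum _).
  apply/negPn/negP => /hasPn h; case/eqP: nz; apply: big1_seq => mm /andP[emm imm].
  by have := h mm imm; rewrite emm /= negbK => /eqP ->; rewrite mulr0.
move=> /hf[i lti lei]; exists i => //; rewrite em mnmDE.
exact: leq_trans lei (leq_addl _ _).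
Qed.

Lemma mono_ideal_nzdiv (i : 'I_n.+1) d : nzdiv (mono_ideal i) ('X_i ^+ d).
Proof.
move=> f h m fm; have := h (U_(i) *+ d + m)%MM.
rewrite mpolyXn mulrC mcoeffMX => /(_ fm)[j ltj lej]; exists j => //.
by move: lej; rewrite mnmDE mulmnE mnm1E -val_eqE gtn_eqF // mul0n.
Qed.

Lemma mono_ideal_adjoin (i : 'I_n.+1) f :
  adjoin (mono_ideal i) ('X_i ^+ e) f <-> mono_ideal i.+1 f.
Proof.
split=> [[c h] m fm|h].
  have [/h[j ltj lej]|] := boolP ((f - 'X_i ^+ e * c)@_m != 0).
    by exists j => //; exact: ltnW.
  rewrite negbK mcoeffB subr_eq0 => /eqP Em; exists i => //.
  move: fm; rewrite Em mpolyXn mulrC => nz.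
  have : m \in msupp (c * 'X_[U_(i) *+ e]) by rewrite mcoeff_msupp.
  rewrite (perm_mem (msuppMX _ _)) => /mapP[m' _ ->].
  by rewrite mnmDE mulmnE mnm1E eqxx mul1n leq_addr.
(* The terms divisible by the power of the variable [i] are divided by it; each remaining term has
   its large exponent at an earlier variable. *)
exists (\sum_(m <- msupp f | (e <= m i)%N) f@_m *: 'X_[m - U_(i) *+ e]).
rewrite [X in X - _](mpolyE f) (bigID (fun m : 'X_{1..n.+1} => (e <= m i)%N)) /=.
rewrite mulr_sumr [X in X + _ - _](eq_bigr (fun m => 'X_i ^+ e * (f@_m *: 'X_[m - U_(i) *+ e]))).
  rewrite addrC addKr.
  rewrite big_seq_cond; apply: (ideal_sum _ (mono_ideal_ideal i)) => m /andP[mf lem].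
  move=> m'; rewrite mcoeffZ mcoeffX; have [<- _|_] := eqVneq m m'; last by rewrite mulr0 eqxx.
  have [|j] := h m; first by rewrite -mcoeff_msupp.
  rewrite ltnS leq_eqVlt => /predU1P[/val_inj->|ltj lej]; last by exists j.
  by rewrite (negPf lem).
move=> m lem; rewrite -scalerAr mpolyXn -mpolyXD; congr (_ *: 'X_[_]).
apply/mnmP=> j; rewrite mnmDE mnmBE mulmnE mnm1E.
by case: eqP => [<-|_]; rewrite ?mul1n ?mul0n ?subnKC ?subn0.
Qed.

Definition mono_powers (j : nat) : seq P := [seq 'X_(inord i) ^+ e | i <- iota 0 j].

Lemma extend_mono_powers j f : (j <= n.+1)%N ->
  extend (fun g : P => g = 0) (mono_powers j) f <-> mono_ideal j f.
Proof.
elim: j f => [|j IHj] f le_jn; first by rewrite mono_ideal0.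
rewrite /mono_powers -(addn1 j) iotaD map_cat /= cats1 extend_rcons add0n addn1.
have ij : (inord j : 'I_n.+1) = j :> nat by rewrite inordK.
rewrite -[in mono_ideal _]ij -mono_ideal_adjoin ij.
by apply: eq_adjoin => g; apply: IHj; exact: ltnW.
Qed.

Lemma mono_powers_reg j : (j <= n.+1)%N ->
  reg_chain (fun g : P => g = 0) (mono_powers j).
Proof.
elim: j => [//|j IHj] le_jn.
rewrite /mono_powers -(addn1 j) iotaD map_cat /= cats1 add0n.
apply/reg_chain_rcons; split; first by apply: IHj; exact: ltnW.
have ij : (inord j : 'I_n.+1) = j :> nat by rewrite inordK.
move=> f /extend_mono_powers h; apply/extend_mono_powers; first exact: ltnW.
rewrite -ij; apply: mono_ideal_nzdiv; rewrite ij; apply: h; exact: ltnW.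
Qed.

(* Modulo the powers [X_i^e] the element [a] is nilpotent, so that [X_j^2 - a]
   divides a power of [X_j]. *)
Lemma mono_ideal_nzdiv_sqr (j : 'I_n.+1) a r : mono_ideal j (a ^+ r) ->
  nzdiv (mono_ideal j) ('X_j ^+ 2 - a).
Proof.
move=> ha f hf; have hI := mono_ideal_ideal j.
apply: (mono_ideal_nzdiv (d := 2 * r)).
rewrite exprM (_ : _ * f = ('X_j ^+ 2) ^+ r * f - a ^+ r * f + a ^+ r * f); last by ring.
apply: (idealD hI); last by have := ideal_mulr f hI ha.
by rewrite -mulrBl subrXX mulrAC; have := ideal_mulr _ hI hf; apply.
Qed.

End MonomialChains.

Lemma dhomogXn (k : fieldType) n (i : 'I_n) d : ('X_i ^+ d : {mpoly k[n]}) \is d.-homog.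
Proof.
rewrite -[X in X.-homog for _]mul1n; apply: dhomogMn.
by rewrite dhomogX /= mdeg1.
Qed.

Section RegularSections.
Variables (k : fieldType) (n e r : nat).
Local Notation P := {mpoly k[n.+1]}.
Variables (j : 'I_n.+1) (a : P) (fs : seq P).
Local Notation q := ('X_j ^+ 2 - a).
Local Notation zero := (fun g : P => g = 0).
Hypothesis e_gt0 : (0 < e)%N.
Hypothesis form_a : a \is 2.-homog.
Hypothesis nil_a : mono_ideal e j (a ^+ r).
Hypothesis size_fs : size fs = j.
Hypothesis homog_fs : forall f, f \in fs -> f \is e.-homog.
Hypothesis fsE : forall i : 'I_n.+1, (i < j)%N -> adjoin zero q ('X_i ^+ e - fs`_i).

(** The powers of the first [j] variables followed by [q] form a regular chain, as [a] is nilpotent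
    modulo these powers. Moving [q] to the front allows each power to be replaced by the element of
    [fs] congruent to it; moving [q] back to the end and dropping it leaves [fs] regular. *)
Lemma section_reg_chain :
  reg_chain zero fs /\ reg_chain zero (q :: fs).
Proof.
have hz : ideal zero by exact: zero_ideal.
have hom0 : homogeneous zero by move=> d f ->; rewrite linear0.
have form_q : pos_form q.
  by exists 2%N => //; apply: rpredB => //; exact: dhomogXn.
have le_jn : (j <= n.+1)%N by exact: ltnW.
have form_X f : f \in mono_powers k n e j -> pos_form f.
  move=> /mapP[i _ ->]; exists e => //.
  exact: dhomogXn.
have h1 : reg_chain zero (rcons (mono_powers k n e j) q).
  apply/reg_chain_rcons; split; first exact: mono_powers_reg.
  move=> f /extend_mono_powers h; apply/extend_mono_powers => //.
  by apply: mono_ideal_nzdiv_sqr nil_a _ _; exact: h.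
have [rq h2] := reg_chain_rotr hz hom0 form_q form_X h1.
have h3 : reg_chain zero (q :: fs).
  split=> //; apply: reg_chain_congr h2; first exact: adjoin_ideal.
    by rewrite size_map size_iota.
  move=> i; rewrite size_map size_iota => ltij.
  rewrite (nth_map 0%N) ?size_iota // nth_iota // add0n.
  have ij : (inord i : 'I_n.+1) = i :> nat by rewrite inordK // (leq_trans ltij).
  by have := fsE (i := inord i); rewrite ij; exact.
split=> //.
have form_fs f : f \in fs -> pos_form f by move=> /homog_fs; exists e.
have := reg_chain_rot hz hom0 form_q form_fs h3.
by move=> /reg_chain_rcons[].
Qed.

End RegularSections.

(** * Gauss and Codazzi equations and the explicit Pfaffians *)

Section StructureConstants.
Variables (R : comNzRingType) (x e1 e2 e3 p q r s : R).
Variables v11 v12 v13 v22 v23 v33 : nat -> R.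

(* [x, axis 1, axis 2, axis 3] are coordinates, [prodc a b f] is the coefficient of the
   [f]-th of them (with [x] the zeroth) in the linear form [v_ab] such that
   [e_a e_b - x v_ab] lies in the ideal, and [smat] is minus the matrix [SM]. *)
Definition axis (a : nat) : R := match a with 1%N => e1 | 2%N => e2 | _ => e3 end.

Definition prodc (a b : nat) : nat -> R :=
  match a, b with
  | 1%N, 1%N => v11
  | 1%N, 2%N | 2%N, 1%N => v12
  | 1%N, 3%N | 3%N, 1%N => v13
  | 2%N, 2%N => v22
  | 2%N, 3%N | 3%N, 2%N => v23
  | _, _ => v33
  end.

Definition smat (a b : nat) : R :=
  match a, b with
  | 1%N, 1%N => p
  | 1%N, 2%N | 2%N, 1%N => r
  | 2%N, 2%N => q
  | 3%N, 3%N => s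
  | _, _ => 0
  end.

Definition linform (u : nat -> R) : R := u 0%N * x + u 1%N * e1 + u 2%N * e2 + u 3%N * e3.

Definition quadric (a b : nat) : R := axis a * axis b - x * linform (prodc a b).

(** Cyclic successor on 1, 2, 3. Index [a] of [smat] stands for the plane spanned by the two axes
    that follow [a]. *)
Definition next3 (a : nat) : nat := match a with 1 => 2 | 2 => 3 | _ => 1 end%N.

Definition smat_prod (h c f : nat) : R :=
  smat h 1 * prodc 1 c f + smat h 2 * prodc 2 c f + smat h 3 * prodc 3 c f.

Definition codazzi (f t : nat) : R :=
  smat_prod (next3 f) t (next3 (next3 f)) - smat_prod (next3 (next3 f)) t (next3 f).

(* The coordinates of [e_b . (e_c . e_d)] for the product [e_a . e_b = v_ab]. *)
Definition act2 (b c d f : nat) : R :=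
  prodc c d 0 * (b == f)%:R + prodc c d 1 * prodc b 1 f + prodc c d 2 * prodc b 2 f + prodc c d 3 * prodc b 3 f.

Definition comm2 (a d f : nat) : R :=
  act2 (next3 a) (next3 (next3 a)) d f - act2 (next3 (next3 a)) (next3 a) d f.

Definition gauss (a h f : nat) : R :=
  comm2 a 1 f * smat 1 h + comm2 a 2 f * smat 2 h + comm2 a 3 f * smat 3 h.

(** At [x = 0], with [D = p * q - r ^+ 2], the Pfaffians of these ten entries are, up to sign, [D]
    times [e1 * e3] and [e2 * e3], and the forms [D * e1 ^+ 2 - s * q * e3 ^+ 2],
    [D * e1 * e2 + s * r * e3 ^+ 2], [D * e2 ^+ 2 - s * p * e3 ^+ 2]. The multiples of [x] correct
    the terms of first order in [x] modulo Codazzi, and those of second order modulo Gauss and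
    Codazzi. *)
Definition pfm12 : R := - s * e3 + x * (smat_prod 3 3 3 - smat_prod 1 1 3 - smat_prod 3 2 2).
Definition pfm13 : R := x * smat_prod 1 2 1 - p * e2.
Definition pfm14 : R := p * e1 - r * e2 - x * (smat_prod 1 1 1 - smat_prod 2 2 1 - smat_prod 1 3 3).
Definition pfm15 : R := r * e1 - x * (smat_prod 2 1 1 - smat_prod 2 3 3).
Definition pfm23 : R := - r * e2 - x * (smat_prod 1 3 3 - smat_prod 1 2 2).
Definition pfm24 : R := r * e1 - q * e2 - x * (smat_prod 2 3 3 - smat_prod 2 2 2 + smat_prod 1 1 2).
Definition pfm25 : R := q * e1 - x * smat_prod 2 1 2.
Definition pfm34 : R := - p * e3 + x * smat_prod 1 3 1.
Definition pfm35 : R := - r * e3 + x * smat_prod 1 3 2.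
Definition pfm45 : R := - q * e3 + x * smat_prod 2 3 2.

Definition struct_pf : seq R := pf pfm12 pfm13 pfm14 pfm15 pfm23 pfm24 pfm25 pfm34 pfm35 pfm45.

(** The array [codazzi] is alternating; the diagonal is listed separately for the sake of
    characteristic two, and likewise in [gauss_eqs]. *)
Definition codazzi_eqs : Prop := forall f t, (0 < f <= 3)%N -> (0 < t <= 3)%N ->
  codazzi f f = 0 /\ codazzi f t + codazzi t f = 0.

Definition gauss_eqs : Prop := forall a h f,
  (0 < a <= 3)%N -> (0 < h <= 3)%N -> (0 < f <= 3)%N ->
  gauss a a f = 0 /\ gauss a h f + gauss h a f = 0.

(** With [b], [c] the axes after [a], multiplying [e_d] by [e_c] and [e_b] in either order gives the
    same polynomial; replacing products by [x] times structure constants, twice on each side, leaves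
    [x ^+ 2] times the commutator. *)
Lemma quadric_comm2 a d : (0 < a <= 3)%N -> (0 < d <= 3)%N ->
  axis (next3 a) * quadric (next3 (next3 a)) d - axis (next3 (next3 a)) * quadric (next3 a) d
    + x * (prodc (next3 (next3 a)) d 1 * quadric (next3 a) 1 + prodc (next3 (next3 a)) d 2 * quadric (next3 a) 2
           + prodc (next3 (next3 a)) d 3 * quadric (next3 a) 3
           - (prodc (next3 a) d 1 * quadric (next3 (next3 a)) 1 + prodc (next3 a) d 2 * quadric (next3 (next3 a)) 2
              + prodc (next3 a) d 3 * quadric (next3 (next3 a)) 3))
  = - (x ^+ 2 * linform (comm2 a d)).
Proof.
by case: a => [|[|[|[|a]]]] // _; case: d => [|[|[|[|d]]]] // _;
  rewrite /quadric /linform /comm2 /act2 /prodc /axis /=; ring.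
Qed.

(** The hypothesis makes the commutators the cross product of column [f] of [E] with row [a] of
    [smat]. Pairing with row [h] gives a 3 by 3 determinant, alternating in [a] and [h]. *)
Lemma gauss_of_comm (E : nat -> nat -> R) :
  (forall a d f, (0 < a <= 3)%N -> (0 < d <= 3)%N -> (0 < f <= 3)%N ->
    comm2 a d f = smat a (next3 (next3 d)) * E (next3 d) f - smat a (next3 d) * E (next3 (next3 d)) f) ->
  gauss_eqs.
Proof.
move=> h a b f ha hb hf; rewrite /gauss !h //=.
by case: a ha => [|[|[|[|a]]]] // _; case: b hb => [|[|[|[|b]]]] // _ /=; split; ring.
Qed.

Hypothesis cod : codazzi_eqs.
Hypothesis gau : gauss_eqs.

Let cod_diag f : (0 < f <= 3)%N -> codazzi f f = 0.
Proof. by move=> hf; have [] := cod hf hf. Qed.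

Let cod_alt f t : (0 < f <= 3)%N -> (0 < t <= 3)%N -> codazzi f t + codazzi t f = 0.
Proof. by move=> hf ht; have [] := cod hf ht. Qed.

Let gau_diag a f : (0 < a <= 3)%N -> (0 < f <= 3)%N -> gauss a a f = 0.
Proof. by move=> ha hf; have [] := gau ha ha hf. Qed.

Let gau_alt a h f : (0 < a <= 3)%N -> (0 < h <= 3)%N -> (0 < f <= 3)%N ->
  gauss a h f + gauss h a f = 0.
Proof. by move=> ha hh hf; have [] := gau ha hh hf. Qed.

(** The added terms form an explicit combination of Gauss and Codazzi expressions, so that the
    equality before these are set to zero is a polynomial identity. The next four lemmas follow the
    same pattern. *)
Lemma struct_pf0 : struct_pf`_0 = - ((p * q - r ^+ 2) * quadric 1 3).
Proof.
have -> : struct_pf`_0 = - ((p * q - r ^+ 2) * quadric 1 3)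
      + (- x * e1 * r * codazzi 3 3
      + x ^+ 2 * (- p * gauss 2 2 2 - q * gauss 1 1 2 + r * (gauss 1 2 2 + gauss 2 1 2) + p * v11 2 * codazzi 3 3 + r * v12 2 * codazzi 3 3)).
  rewrite /struct_pf /= /pfm12 /pfm13 /pfm14 /pfm15 /pfm23 /pfm24 /pfm25 /pfm34 /pfm35 /pfm45.
  by rewrite /quadric /linform /gauss /comm2 /codazzi /act2 /smat_prod /prodc /smat /axis /=; ring.
by rewrite ?cod_diag ?cod_alt ?gau_diag ?gau_alt // !mulr0 ?oppr0 ?addr0 ?mulr0 ?addr0.
Qed.

Lemma struct_pf1 : struct_pf`_1 = - ((p * q - r ^+ 2) * quadric 2 3).
Proof.
have -> : struct_pf`_1 = - ((p * q - r ^+ 2) * quadric 2 3)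
      + (x * e1 * p * codazzi 3 3
      + x ^+ 2 * (p * gauss 2 2 1 + q * gauss 1 1 1 - r * (gauss 1 2 1 + gauss 2 1 1) - p * v11 1 * codazzi 3 3 + p * v13 3 * codazzi 3 3 - r * v12 1 * codazzi 3 3 + r * v23 3 * codazzi 3 3)).
  rewrite /struct_pf /= /pfm12 /pfm13 /pfm14 /pfm15 /pfm23 /pfm24 /pfm25 /pfm34 /pfm35 /pfm45.
  by rewrite /quadric /linform /gauss /comm2 /codazzi /act2 /smat_prod /prodc /smat /axis /=; ring.
by rewrite ?cod_diag ?cod_alt ?gau_diag ?gau_alt // !mulr0 ?oppr0 ?addr0 ?mulr0 ?addr0.
Qed.

Lemma struct_pf2 : struct_pf`_2 = - ((p * q - r ^+ 2) * quadric 1 1 - s * q * quadric 3 3).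
Proof.
have -> : struct_pf`_2 = - ((p * q - r ^+ 2) * quadric 1 1 - s * q * quadric 3 3)
      + (x * e1 * q * (codazzi 2 3 + codazzi 3 2) - x * e2 * q * (codazzi 1 3 + codazzi 3 1) + x * e3 * r * codazzi 1 1
      + x ^+ 2 * (q * (gauss 1 3 2 + gauss 3 1 2) - r * (gauss 2 3 2 + gauss 3 2 2) - q * v12 2 * (codazzi 2 3 + codazzi 3 2) - q * v12 3 * codazzi 3 3 + q * v22 2 * (codazzi 1 3 + codazzi 3 1) - q * v23 1 * codazzi 1 1 - q * v23 3 * (codazzi 1 3 + codazzi 3 1) - r * v11 2 * (codazzi 2 3 + codazzi 3 2) - r * v11 3 * codazzi 3 3 + r * v12 2 * (codazzi 1 3 + codazzi 3 1) - r * v13 1 * codazzi 1 1 - r * v13 3 * (codazzi 1 3 + codazzi 3 1))).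
  rewrite /struct_pf /= /pfm12 /pfm13 /pfm14 /pfm15 /pfm23 /pfm24 /pfm25 /pfm34 /pfm35 /pfm45.
  by rewrite /quadric /linform /gauss /comm2 /codazzi /act2 /smat_prod /prodc /smat /axis /=; ring.
by rewrite ?cod_diag ?cod_alt ?gau_diag ?gau_alt // !mulr0 ?oppr0 ?addr0 ?mulr0 ?addr0.
Qed.

Lemma struct_pf3 : struct_pf`_3 = - ((p * q - r ^+ 2) * quadric 1 2 + s * r * quadric 3 3).
Proof.
have -> : struct_pf`_3 = - ((p * q - r ^+ 2) * quadric 1 2 + s * r * quadric 3 3)
      + (- x * e1 * r * (codazzi 2 3 + codazzi 3 2) + x * e2 * r * (codazzi 1 3 + codazzi 3 1) - x * e3 * p * codazzi 1 1
      + x ^+ 2 * (p * (gauss 2 3 2 + gauss 3 2 2) - r * (gauss 1 3 2 + gauss 3 1 2) + p * v11 2 * (codazzi 2 3 + codazzi 3 2) - p * v12 2 * (codazzi 1 3 + codazzi 3 1) - p * v13 2 * (codazzi 1 2 + codazzi 2 1) + p * v13 3 * (codazzi 1 3 + codazzi 3 1) + p * v23 2 * codazzi 1 1 + r * v12 2 * (codazzi 2 3 + codazzi 3 2) - r * v13 2 * codazzi 2 2 - r * v22 2 * (codazzi 1 3 + codazzi 3 1) + r * v23 3 * (codazzi 1 3 + codazzi 3 1))).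
  rewrite /struct_pf /= /pfm12 /pfm13 /pfm14 /pfm15 /pfm23 /pfm24 /pfm25 /pfm34 /pfm35 /pfm45.
  by rewrite /quadric /linform /gauss /comm2 /codazzi /act2 /smat_prod /prodc /smat /axis /=; ring.
by rewrite ?cod_diag ?cod_alt ?gau_diag ?gau_alt // !mulr0 ?oppr0 ?addr0 ?mulr0 ?addr0.
Qed.

Lemma struct_pf4 : struct_pf`_4 = - ((p * q - r ^+ 2) * quadric 2 2 - s * p * quadric 3 3).
Proof.
have -> : struct_pf`_4 = - ((p * q - r ^+ 2) * quadric 2 2 - s * p * quadric 3 3)
      + (x * e1 * p * (codazzi 2 3 + codazzi 3 2) - x * e2 * p * (codazzi 1 3 + codazzi 3 1) - x * e3 * p * (codazzi 1 2 + codazzi 2 1) - x * e3 * r * codazzi 2 2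
      + x ^+ 2 * (- p * (gauss 2 3 1 + gauss 3 2 1) + r * (gauss 1 3 1 + gauss 3 1 1) - p * v11 1 * (codazzi 2 3 + codazzi 3 2) + p * v12 1 * (codazzi 1 3 + codazzi 3 1) + p * v13 1 * (codazzi 1 2 + codazzi 2 1) + p * v13 3 * (codazzi 2 3 + codazzi 3 2) - p * v23 1 * codazzi 1 1 - r * v12 1 * (codazzi 2 3 + codazzi 3 2) + r * v13 1 * codazzi 2 2 + r * v22 1 * (codazzi 1 3 + codazzi 3 1) + r * v23 3 * (codazzi 2 3 + codazzi 3 2))).
  rewrite /struct_pf /= /pfm12 /pfm13 /pfm14 /pfm15 /pfm23 /pfm24 /pfm25 /pfm34 /pfm35 /pfm45.
  by rewrite /quadric /linform /gauss /comm2 /codazzi /act2 /smat_prod /prodc /smat /axis /=; ring.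
by rewrite ?cod_diag ?cod_alt ?gau_diag ?gau_alt // !mulr0 ?oppr0 ?addr0 ?mulr0 ?addr0.
Qed.

End StructureConstants.

Section MapStructureConstants.
Variables (R R' : comNzRingType) (g : {rmorphism R -> R'}) (p q r s : R).
Variables v11 v12 v13 v22 v23 v33 : nat -> R.

Lemma prodc_map a b f : prodc (g \o v11) (g \o v12) (g \o v13) (g \o v22) (g \o v23) (g \o v33) a b f =
  g (prodc v11 v12 v13 v22 v23 v33 a b f).
Proof.
by case: a => [|[|[|[|a]]]]; case: b => [|[|[|[|b]]]].
Qed.

Lemma smat_map a b : smat (g p) (g q) (g r) (g s) a b = g (smat p q r s a b).
Proof.
by case: a => [|[|[|[|a]]]]; case: b => [|[|[|[|b]]]]; rewrite /= ?rmorph0.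
Qed.

Lemma comm2_map a d f :
  comm2 (g \o v11) (g \o v12) (g \o v13) (g \o v22) (g \o v23) (g \o v33) a d f =
  g (comm2 v11 v12 v13 v22 v23 v33 a d f).
Proof. by rewrite /comm2 /act2 !prodc_map rmorphB !rmorphD !rmorphM /= !rmorph_nat. Qed.

Lemma codazzi_map f t :
  codazzi (g p) (g q) (g r) (g s) (g \o v11) (g \o v12) (g \o v13) (g \o v22) (g \o v23) (g \o v33) f t =
  g (codazzi p q r s v11 v12 v13 v22 v23 v33 f t).
Proof. by rewrite /codazzi /smat_prod !smat_map !prodc_map rmorphB !rmorphD !rmorphM. Qed.

Lemma gauss_map a h f :
  gauss (g p) (g q) (g r) (g s) (g \o v11) (g \o v12) (g \o v13) (g \o v22) (g \o v23) (g \o v33) a h f =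
  g (gauss p q r s v11 v12 v13 v22 v23 v33 a h f).
Proof.
rewrite /gauss !smat_map !comm2_map; move: (comm2 _ _ _ _ _ _ _ _ _) (comm2 _ _ _ _ _ _ _ _ _) (comm2 _ _ _ _ _ _ _ _ _) => c1 c2 c3.
by rewrite !rmorphD !rmorphM.
Qed.

Lemma codazzi_eqs_map : codazzi_eqs p q r s v11 v12 v13 v22 v23 v33 ->
  codazzi_eqs (g p) (g q) (g r) (g s) (g \o v11) (g \o v12) (g \o v13) (g \o v22) (g \o v23) (g \o v33).
Proof.
move=> h f t hf ht; have [h1 h2] := h f t hf ht.
by rewrite !codazzi_map -rmorphD h1 h2 rmorph0.
Qed.

Lemma gauss_eqs_map : gauss_eqs p q r s v11 v12 v13 v22 v23 v33 ->
  gauss_eqs (g p) (g q) (g r) (g s) (g \o v11) (g \o v12) (g \o v13) (g \o v22) (g \o v23) (g \o v33).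
Proof.
move=> H a h f ha hh hf; have [h1 h2] := H a h f ha hh hf.
by rewrite !gauss_map -rmorphD h1 h2 rmorph0.
Qed.

End MapStructureConstants.

(** * Curvature of the product defined by a cubic form *)

Section CubicForm.
Variables (k : fieldType) (phi : {linear {mpoly k[4]} -> k^o}).
Local Notation P := {mpoly k[4]}.
Local Notation o := (@inord 3).

Definition coef3 (i j l : 'I_4) : k := phi ('X_i * 'X_j * 'X_l).

Definition slice_mx (a : 'I_4) : 'M[k]_4 := \matrix_(i, j) coef3 a i j.

Local Notation Q := (slice_mx 0).
Local Notation Qi := (invmx (slice_mx 0)).

Lemma sliceC a b c : slice_mx a b c = slice_mx b a c.
Proof. by rewrite !mxE /coef3 ['X_a * _]mulrC. Qed.

Lemma tr_slice a : (slice_mx a)^T = slice_mx a.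
Proof. by apply/matrixP=> i j; rewrite !mxE /coef3 mulrAC. Qed.

Lemma tr_Qi : Qi^T = Qi.
Proof. by rewrite trmx_inv tr_slice. Qed.

(** The pairing of [X_a X_b] with [X_c X_d] in coordinates: row [d] of [slice_mx c *m Qi] is the
    linear form attached to [X_c X_d], and [Qi] is symmetric. *)
Definition cpair (a b c d : 'I_4) : k := (slice_mx a *m Qi *m slice_mx c) b d.

Lemma cpairCl a b c d : cpair a b c d = cpair b a c d.
Proof.
rewrite /cpair -!mulmxA [LHS]mxE [RHS]mxE; apply: eq_bigr => i _.
by rewrite sliceC.
Qed.

Lemma cpair_sym a b c d : cpair a b c d = cpair c d a b.
Proof.
rewrite /cpair -[slice_mx a *m _ *m _]trmxK [LHS]mxE.
by rewrite !trmx_mul !tr_slice tr_Qi mulmxA.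
Qed.

Lemma cpairCr a b c d : cpair a b c d = cpair a b d c.
Proof. by rewrite cpair_sym cpairCl cpair_sym. Qed.

Definition curv (b c d g : 'I_4) : k := cpair c d b g - cpair b d c g.

Lemma curvNl b c d g : curv b c d g = - curv c b d g.
Proof. by rewrite opprB. Qed.

Lemma curv_sym b c d g : curv b c d g = curv d g b c.
Proof.
rewrite /curv (cpair_sym g b) [cpair d c g b]cpairCl [cpair c d g b]cpairCr; congr (_ - _).
by rewrite cpair_sym (cpair_sym d b) cpairCl cpairCr.
Qed.

Lemma curvNr b c d g : curv b c d g = - curv b c g d.
Proof. by rewrite curv_sym curvNl curv_sym. Qed.

Lemma curvxx b c d : curv b c d d = 0.
Proof. by rewrite /curv cpair_sym subrr. Qed.

Hypothesis Q_unit : Q \in unitmx.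

Lemma slice_Qi0 a b : (slice_mx a *m Qi) 0 b = (a == b)%:R.
Proof.
have -> : (slice_mx a *m Qi) 0 b = (Q *m Qi) a b.
  by rewrite [LHS]mxE [RHS]mxE; apply: eq_bigr => i _; rewrite sliceC.
by rewrite mulmxV // mxE.
Qed.

(** [X_0] acts as the identity, so the two pairings both reduce to the value of [phi] on
    [X_b X_c X_d]. The curvature therefore lives on the other three variables. *)
Lemma curv0 b c d : curv b c d 0 = 0.
Proof.
suff E a b' : cpair a 0 b' d = slice_mx b' a d.
  by rewrite curvNr /curv !E [slice_mx c b d]sliceC subrr oppr0.
rewrite /cpair mxE (bigD1 a) //= slice_Qi0 eqxx mul1r big1 ?addr0 // => i ne.
by rewrite slice_Qi0 eq_sym (negPf ne) mul0r.
Qed.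

Lemma sum_ord4 (F : 'I_4 -> k) :
  \sum_i F i = F (o 0) + F (o 1) + F (o 2) + F (o 3).
Proof.
rewrite !big_ord_recl big_ord0 addr0 !addrA.
by do !congr (_ + _); congr (F _); apply: val_inj; rewrite /= inordK.
Qed.

Lemma o0 : o 0 = 0.
Proof. by apply: val_inj; rewrite /= inordK. Qed.

Definition mulc (a b f : nat) : k := (slice_mx (o a) *m Qi) (o b) (o f).

Lemma mulcC a b f : mulc a b f = mulc b a f.
Proof.
by rewrite /mulc [LHS]mxE [RHS]mxE; apply: eq_bigr => i _; rewrite sliceC.
Qed.

Local Notation cv a b c d := (curv (o a) (o b) (o c) (o d)).
Local Notation p := (cv 2 3 2 3).
Local Notation q := (cv 3 1 3 1).
Local Notation r := (cv 2 3 3 1).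
Local Notation s := (cv 1 2 1 2).
Local Notation v := (prodc (mulc 1 1) (mulc 1 2) (mulc 1 3) (mulc 2 2) (mulc 2 3) (mulc 3 3)).
Local Notation act := (act2 (mulc 1 1) (mulc 1 2) (mulc 1 3) (mulc 2 2) (mulc 2 3) (mulc 3 3)).
Local Notation comm := (comm2 (mulc 1 1) (mulc 1 2) (mulc 1 3) (mulc 2 2) (mulc 2 3) (mulc 3 3)).

Lemma vE a b : (0 < a <= 3)%N -> (0 < b <= 3)%N -> v a b = mulc a b.
Proof.
by case: a => [|[|[|[|a]]]] // _; case: b => [|[|[|[|b]]]] // _;
  apply: funext => f //=; exact: mulcC.
Qed.

Lemma actE b c d f : (0 < b <= 3)%N -> (0 < c <= 3)%N -> (0 < d <= 3)%N -> (f <= 3)%N ->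
  act b c d f = (slice_mx (o c) *m Qi *m (slice_mx (o b) *m Qi)) (o d) (o f).
Proof.
move=> hb hc hd hf; rewrite mxE sum_ord4 /act2 !vE // /mulc o0 slice_Qi0.
congr (_ * _%:R + _ + _ + _); congr nat_of_bool.
have hb3 : (b <= 3)%N by case/andP: hb.
by rewrite -val_eqE /= !inordK.
Qed.

(** Lowering the index of the commutator with the form [Q] gives the curvature; [Qi] raises it
    again. *)
Lemma commE a d f : (0 < a <= 3)%N -> (0 < d <= 3)%N -> (f <= 3)%N ->
  comm a d f = \sum_g curv (o (next3 a)) (o (next3 (next3 a))) (o d) g * Qi g (o f).
Proof.
move=> ha hd hf.
have hn b : (0 < next3 b <= 3)%N by case: b => [|[|[|]]].
rewrite /comm2 !actE // !mulmxA.
transitivity (((slice_mx (o (next3 (next3 a))) *m Qi *m slice_mx (o (next3 a)) -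
  slice_mx (o (next3 a)) *m Qi *m slice_mx (o (next3 (next3 a)))) *m Qi) (o d) (o f)).
  by rewrite mulmxBl [in RHS]mxE [in X in _ = _ + X]mxE.
by rewrite mxE; apply: eq_bigr => g _; rewrite [in LHS]mxE [in X in _ + X]mxE.
Qed.

Hypothesis S13 : cv 2 3 1 2 = 0.
Hypothesis S23 : cv 3 1 1 2 = 0.

Lemma curv_next3 a d : (0 < a <= 3)%N -> (0 < d <= 3)%N ->
  [/\ curv (o (next3 a)) (o (next3 (next3 a))) (o d) (o d) = 0,
      curv (o (next3 a)) (o (next3 (next3 a))) (o d) (o (next3 d)) = smat p q r s a (next3 (next3 d)) &
      curv (o (next3 a)) (o (next3 (next3 a))) (o d) (o (next3 (next3 d))) = - smat p q r s a (next3 d)].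
Proof.
move=> ha hd; split; first exact: curvxx.
  case: a ha => [|[|[|[|a]]]] // _; case: d hd => [|[|[|[|d]]]] // _ /=;
    rewrite ?S13 ?S23 //; rewrite curv_sym ?S13 ?S23 //.
rewrite curvNr; congr (- _); case: a ha => [|[|[|[|a]]]] // _; case: d hd => [|[|[|[|d]]]] // _ /=;
    rewrite ?S13 ?S23 //; rewrite curv_sym ?S13 ?S23 //.
Qed.

(** On three variables a form that is skew in its last two indices is a vector, so that the
    contraction is a component of a cross product with row [a] of [smat]. *)
Lemma curv_sum a d (F : 'I_4 -> k) : (0 < a <= 3)%N -> (0 < d <= 3)%N ->
  \sum_g curv (o (next3 a)) (o (next3 (next3 a))) (o d) g * F g =
  smat p q r s a (next3 (next3 d)) * F (o (next3 d)) - smat p q r s a (next3 d) * F (o (next3 (next3 d))).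
Proof.
move=> ha hd; have [h0 h1 h2] := curv_next3 ha hd; rewrite sum_ord4 o0 curv0 mul0r add0r.
by case: d hd h0 h1 h2 => [|[|[|[|d]]]] //= _ h0 h1 h2; rewrite h0 h1 h2; ring.
Qed.

Lemma gauss_holds : gauss_eqs p q r s (mulc 1 1) (mulc 1 2) (mulc 1 3) (mulc 2 2) (mulc 2 3) (mulc 3 3).
Proof.
apply: (gauss_of_comm (E := fun g f => Qi (o g) (o f))) => a d f ha hd hf.
by rewrite commE ?curv_sum //; case/andP: hf.
Qed.

Definition triple (a b c : 'I_4) : 'M[k]_4 := slice_mx a *m Qi *m slice_mx b *m Qi *m slice_mx c.

Lemma tripleC a b c i j : triple a b c i j = triple c b a j i.
Proof.
rewrite /triple -[slice_mx a *m _ *m _ *m _ *m _]trmxK [LHS]mxE.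
by rewrite !trmx_mul !tr_slice tr_Qi !mulmxA.
Qed.

(* By Jacobi's identity for the multiplication operators. *)
Lemma codazziE f t : (0 < f <= 3)%N -> (0 < t <= 3)%N ->
  codazzi p q r s (mulc 1 1) (mulc 1 2) (mulc 1 3) (mulc 2 2) (mulc 2 3) (mulc 3 3) f t =
  let c a b d := triple (o a) (o b) (o d) (o f) (o t) in
  c 2 3 1 - c 1 3 2 + c 3 1 2 - c 2 1 3 + c 1 2 3 - c 3 2 1.
Proof.
move=> hf ht /=.
have E a : (0 < a <= 3)%N ->
    triple (o (next3 (next3 a))) (o (next3 a)) (o a) (o f) (o t) -
    triple (o (next3 a)) (o (next3 (next3 a))) (o a) (o f) (o t) =
    smat p q r s a (next3 (next3 f)) * mulc a t (next3 f) - smat p q r s a (next3 f) * mulc a t (next3 (next3 f)).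
  move=> ha; rewrite -(curv_sum (fun g => (slice_mx (o a) *m Qi) (o t) g)) //.
  transitivity (((slice_mx (o (next3 (next3 a))) *m Qi *m slice_mx (o (next3 a)) -
      slice_mx (o (next3 a)) *m Qi *m slice_mx (o (next3 (next3 a)))) *m (slice_mx (o a) *m Qi)^T) (o f) (o t)).
    rewrite trmx_mul tr_slice tr_Qi mulmxBl /triple !mulmxA.
    by rewrite [in RHS]mxE [in X in _ = _ + X]mxE.
  rewrite mxE; apply: eq_bigr => g _.
  by rewrite [in LHS]mxE [in X in _ + X]mxE [_^T _ _]mxE.
have := (E 1%N isT, E 2%N isT, E 3%N isT); rewrite /= => -[[E1 E2] E3].
have regroup (c1 c2 c3 c4 c5 c6 : k) : c1 - c2 + c3 - c4 + c5 - c6 =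
  - ((c6 - c1) + (c2 - c3) + (c4 - c5)) by ring.
rewrite regroup.
have h a : (0 < a <= 3)%N -> v a t =1 mulc a t by move=> ha g; rewrite vE.
have hn b : (0 < next3 b <= 3)%N by case: b => [|[|[|]]].
rewrite E1 E2 E3 /codazzi /smat_prod !h //.
by case: f hf {E E1 E2 E3} => [|[|[|[|f]]]] // _ /=; ring.
Qed.

(** By [codazziE] the array is the full antisymmetrization of [triple] in its three slices.
    Reversing three factors is an odd permutation and transposes the matrix, so the array is skew;
    on the diagonal the six terms cancel in pairs. *)
Lemma codazzi_holds : codazzi_eqs p q r s (mulc 1 1) (mulc 1 2) (mulc 1 3) (mulc 2 2) (mulc 2 3) (mulc 3 3).
Proof.
move=> f t hf ht; rewrite !codazziE //=.
have alt (Z : 'I_4 -> 'I_4 -> 'I_4 -> 'I_4 -> 'I_4 -> k) (a b c i j : 'I_4) :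
    (forall a b c i j, Z a b c i j = Z c b a j i) ->
    let A i j := Z b c a i j - Z a c b i j + Z c a b i j - Z b a c i j +
      Z a b c i j - Z c b a i j in A i i = 0 /\ A i j + A j i = 0.
  move=> ZC /=; split.
    by rewrite (ZC a c b) (ZC b a c) (ZC c b a); ring.
  rewrite (ZC b c a j) (ZC a c b j) (ZC c a b j) (ZC b a c j) (ZC a b c j) (ZC c b a j).
  by ring.
exact: (alt triple (o 1) (o 2) (o 3) (o f) (o t) tripleC).
Qed.

End CubicForm.

(** * The annihilator of the cubic form as Pfaffian ideal plus one quadric *)

Lemma index3_ind (H : nat -> nat -> Prop) :
  H 1%N 1%N -> H 1%N 2%N -> H 1%N 3%N -> H 2%N 1%N -> H 2%N 2%N -> H 2%N 3%N -> H 3%N 1%N -> H 3%N 2%N -> H 3%N 3%N ->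
  forall a b, (0 < a <= 3)%N -> (0 < b <= 3)%N -> H a b.
Proof.
by move=> h11 h12 h13 h21 h22 h23 h31 h32 h33 [|[|[|[|a]]]] // [|[|[|[|b]]]].
Qed.

Lemma curv_elim (R : comNzRingType) (I : R -> Prop) (p q r c x L1 L2 L3 : R) :
  ideal I -> c * (p * q - r ^+ 2) = 1 ->
  I (x * - (r * L3)) -> I (x * (p * L3)) ->
  I (x * (r * L1 - p * L2)) -> I (x * (q * L1 - r * L2)) ->
  [/\ I (x * L1), I (x * L2) & I (x * L3)].
Proof.
move=> hI hc h11 h12 h13 h23; split.
- rewrite -[x * L1]mul1r -hc (_ : _ * (x * L1) = (c * p) * (x * (q * L1 - r * L2)) -
    (c * r) * (x * (r * L1 - p * L2))); last by ring.
  by apply: (idealB hI); exact: (idealM hI).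
- rewrite -[x * L2]mul1r -hc (_ : _ * (x * L2) = (c * r) * (x * (q * L1 - r * L2)) -
    (c * q) * (x * (r * L1 - p * L2))); last by ring.
  by apply: (idealB hI); exact: (idealM hI).
- rewrite -[x * L3]mul1r -hc (_ : _ * (x * L3) = (c * q) * (x * (p * L3)) +
    (c * r) * (x * - (r * L3))); last by ring.
  by apply: (idealD hI); exact: (idealM hI).
Qed.

Section CubicIdeal.
Variables (k : fieldType) (phi : {linear {mpoly k[4]} -> k^o}).
Local Notation P := {mpoly k[4]}.
Local Notation o := (@inord 3).
Local Notation slice := (slice_mx phi).
Local Notation Q := (slice 0).
Local Notation Qi := (invmx (slice 0)).
Local Notation vf := (mulc phi).
Local Notation cv a b c d := (curv phi (o a) (o b) (o c) (o d)).
Local Notation p := (cv 2 3 2 3).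
Local Notation q := (cv 3 1 3 1).
Local Notation r := (cv 2 3 3 1).
Local Notation s := (cv 1 2 1 2).

Hypothesis phi_deg : forall d (f : P), d != 3%N -> f \is d.-homog -> phi f = 0.
Hypothesis Q_unit : Q \in unitmx.
Hypothesis S13 : cv 2 3 1 2 = 0.
Hypothesis S23 : cv 3 1 1 2 = 0.
Hypothesis D_neq0 : p * q - r ^+ 2 != 0.

Local Notation C := (@mpolyC 4 k).
Local Notation Y i := ('X_(inord i%N) : P).
Local Notation x0 := ('X_0 : P).

Definition lin4 (u : 'rV[k]_4) : P := \sum_i u 0 i *: 'X_i.

Lemma lin4_linear : linear lin4.
Proof.
move=> a u w; rewrite /lin4 scaler_sumr -big_split; apply: eq_bigr => i _ /=.
by rewrite !mxE scalerDl scalerA.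
Qed.

HB.instance Definition _ := GRing.isLinear.Build k 'rV[k]_4 P _ lin4 lin4_linear.

Local Notation vP a b := (C \o vf a b).
Local Notation v := (prodc (vP 1 1) (vP 1 2) (vP 1 3) (vP 2 2) (vP 2 3) (vP 3 3)).
Local Notation comm := (comm2 (vP 1 1) (vP 1 2) (vP 1 3) (vP 2 2) (vP 2 3) (vP 3 3)).
Local Notation quad :=
  (quadric x0 (Y 1) (Y 2) (Y 3) (vP 1 1) (vP 1 2) (vP 1 3) (vP 2 2) (vP 2 3) (vP 3 3)).
Local Notation pfs :=
  (struct_pf x0 (Y 1) (Y 2) (Y 3) (C p) (C q) (C r) (C s)
    (vP 1 1) (vP 1 2) (vP 1 3) (vP 2 2) (vP 2 3) (vP 3 3)).
Local Notation lform := (linform x0 (Y 1) (Y 2) (Y 3)).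

Definition cubic_ann (f : P) : Prop := forall g, phi (f * g) = 0.

Definition section_ideal : P -> Prop := adjoin (gen pfs) (quad 3 3).
Local Notation N := section_ideal.

Lemma section_ideal_ideal : ideal N.
Proof. by apply: adjoin_ideal; exact: gen_ideal. Qed.
Local Notation hN := section_ideal_ideal.

Lemma sum_ord4P (F : 'I_4 -> P) :
  \sum_i F i = F (o 0) + F (o 1) + F (o 2) + F (o 3).
Proof.
rewrite !big_ord_recl big_ord0 addr0 !addrA.
by do !congr (_ + _); congr (F _); apply: val_inj; rewrite /= inordK.
Qed.

Lemma linformE (u : nat -> k) : lform (C \o u) = lin4 (\row_i u i).
Proof.
by rewrite /lin4 sum_ord4P /linform !mxE !inordK //= -!mul_mpolyC o0.
Qed.

Lemma linform_prodc a b : (0 < a <= 3)%N -> (0 < b <= 3)%N ->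
  lform (v a b) = lin4 (row (o b) (slice (o a) *m Qi)).
Proof.
move=> ha hb; have -> : v a b = C \o vf a b.
  by apply: funext => f; rewrite (prodc_map C) (vE phi ha hb).
rewrite linformE; congr lin4; apply/rowP=> i; rewrite !mxE /mulc.
by rewrite !mxE inord_val.
Qed.

Lemma quad_in a b : (0 < a <= 3)%N -> (0 < b <= 3)%N -> N (quad a b).
Proof.
have gau := gauss_eqs_map C (gauss_holds Q_unit S13 S23).
have cod := codazzi_eqs_map C (codazzi_holds Q_unit S13 S23).
have pfE i (lti : (i < 5)%N) : N (pfs`_i).
  by apply: sub_adjoin; apply: gen_mem; apply: mem_nth.
have quad33 : N (quad 3 3).
  by rewrite -[quad 3 3]mulr1; apply: mem_adjoin; exact: gen_ideal.
have unD f : N ((C p * C q - C r ^+ 2) * f) -> N f.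
  move=> h; have -> : f = C (p * q - r ^+ 2)^-1 * ((C p * C q - C r ^+ 2) * f).
    by rewrite -!(rmorphM, rmorphXn, rmorphB) mulrA -rmorphM mulVf // rmorph1 mul1r.
  exact: (idealM hN).
have pfN i (lti : (i < 5)%N) : N (- pfs`_i) by exact/(idealN hN)/pfE.
have q13 : N (quad 1 3).
  by apply: unD; have := pfN 0%N isT; rewrite (struct_pf0 _ _ _ _ cod gau) opprK.
have q23 : N (quad 2 3).
  by apply: unD; have := pfN 1%N isT; rewrite (struct_pf1 _ _ _ _ cod gau) opprK.
have q11 : N (quad 1 1).
  apply: unD; rewrite -[X in N X](subrK (C s * C q * quad 3 3)).
  apply: (idealD hN); last exact: (idealM hN).
  by have := pfN 2%N isT; rewrite (struct_pf2 _ _ _ _ cod gau) opprK.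
have q12 : N (quad 1 2).
  apply: unD; rewrite -[X in N X](addrK (C s * C r * quad 3 3)).
  apply: (idealB hN); last exact: (idealM hN).
  by have := pfN 3%N isT; rewrite (struct_pf3 _ _ _ _ cod gau) opprK.
have q22 : N (quad 2 2).
  apply: unD; rewrite -[X in N X](subrK (C s * C p * quad 3 3)).
  apply: (idealD hN); last exact: (idealM hN).
  by have := pfN 4%N isT; rewrite (struct_pf4 _ _ _ _ cod gau) opprK.
have quadC i j : quad i j = quad j i.
  rewrite /quadric mulrC; congr (_ - _ * lform _).
  by case: i => [|[|[|[|i]]]]; case: j => [|[|[|[|j]]]].
apply: (@index3_ind (fun a b => N (quad a b))).
- exact: q11.
- exact: q12.
- exact: q13.
- by rewrite quadC; exact: q12.
- exact: q22.
- exact: q23.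
- by rewrite quadC; exact: q13.
- by rewrite quadC; exact: q23.
- exact: quad33.
Qed.

(** Modulo [N], multiplication of linear forms by [X_i] is [X_0] times the i-th operator. Products
    involving [X_0] satisfy this identically; the others are the quadrics of [quad_in]. *)
Lemma mul_lin4 (i : 'I_4) u : N ('X_i * lin4 u - 'X_0 * lin4 (u *m (slice i *m Qi))).
Proof.
have E (j : 'I_4) : N ('X_i * 'X_j - 'X_0 * lin4 (row j (slice i *m Qi))).
  have lin0 (l : 'I_4) : lin4 (row 0 (slice l *m Qi)) = 'X_l.
    rewrite /lin4 (bigD1 l) //= mxE (slice_Qi0 Q_unit) eqxx scale1r big1 ?addr0 // => l' ne.
    by rewrite mxE (slice_Qi0 Q_unit) eq_sym (negPf ne) scale0r.
  have [->|ni0] := eqVneq i 0.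
    rewrite mulmxV // /lin4 (bigD1 j) //= !mxE eqxx scale1r big1 ?addr0.
      by rewrite subrr; exact: (ideal0 hN).
    by move=> l ne; rewrite !mxE eq_sym (negPf ne) scale0r.
  have [->|nj0] := eqVneq j 0.
    by rewrite lin0 mulrC subrr; exact: (ideal0 hN).
  have pos (l : 'I_4) : l != 0 -> (0 < l <= 3)%N by case: l => [[|[|[|[|]]]]].
  have := quad_in (pos _ ni0) (pos _ nj0); rewrite /quadric linform_prodc ?pos // !inord_val.
  have eE (l : 'I_4) : l != 0 -> axis (Y 1) (Y 2) (Y 3) l = 'X_l.
    case: l => [[|[|[|[|l]]]]] ltl //= _; congr 'X_(_); apply: val_inj;
      by rewrite /= inordK.
  by rewrite !eE.
rewrite (_ : _ - _ = \sum_j C (u 0 j) * ('X_i * 'X_j - 'X_0 * lin4 (row j (slice i *m Qi)))).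
  by apply: (ideal_sum _ hN) => j _; exact: (idealM hN).
rewrite [u in u *m _]row_sum_delta mulmx_suml linear_sum /=.
rewrite [lin4 u]/lin4 !mulr_sumr -sumrB.
apply: eq_bigr => j _; rewrite -scalemxAl -rowE linearZ /= mulrBr !mul_mpolyC.
by rewrite !scalerAr.
Qed.

(** The rows of [Qi] are the basis dual to the variables under [Q]. By [quadric_comm2], [X_0 ^+ 2]
    times any commutator is in [N]; commutators are combinations of dual forms with coefficients
    from [smat], and the invertible minor isolates each dual form. *)
Lemma x2_dual g : (0 < g <= 3)%N -> N ('X_0 ^+ 2 * lin4 (row (o g) Qi)).
Proof.
pose L g := lin4 (row (o g) Qi).
have rel a d : (0 < a <= 3)%N -> (0 < d <= 3)%N ->
    N ('X_0 ^+ 2 * (C (smat p q r s a (next3 (next3 d))) * L (next3 d) - C (smat p q r s a (next3 d)) * L (next3 (next3 d)))).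
  move=> ha hd; have hn b : (0 < next3 b <= 3)%N by case: b => [|[|[|]]].
  have E : lform (comm a d) =
      C (smat p q r s a (next3 (next3 d))) * L (next3 d) - C (smat p q r s a (next3 d)) * L (next3 (next3 d)).
    have -> : comm a d = C \o (fun f => comm2 (vf 1 1) (vf 1 2) (vf 1 3) (vf 2 2) (vf 2 3) (vf 3 3) a d f).
      by apply: funext => f; rewrite comm2_map.
    rewrite linformE !mul_mpolyC -!linearZ -linearB /=; congr lin4.
    apply/rowP=> i; have i3 : (i <= 3)%N by rewrite -ltnS.
    rewrite [LHS]mxE (commE Q_unit) //.
    by rewrite (curv_sum Q_unit S13 S23) // !mxE inord_val.
  rewrite -E -[X in N X]opprK; apply: (idealN hN).
  have := quadric_comm2 x0 (Y 1) (Y 2) (Y 3) (vP 1 1) (vP 1 2) (vP 1 3) (vP 2 2)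
    (vP 2 3) (vP 3 3) ha hd.
  move=> <-.
  have h b c d' : (0 < b <= 3)%N -> (0 < c <= 3)%N -> N (d' * quad b c).
    by move=> hb hc; apply: (idealM hN); exact: quad_in.
  apply: (idealD hN).
    apply: (idealB hN).
      exact: (h _ _ _ (hn _) hd).
    exact: (h _ _ _ (hn _) hd).
  have h1 b c : (0 < b <= 3)%N ->
      N (v c d 1 * quad b 1 + v c d 2 * quad b 2 + v c d 3 * quad b 3).
    move=> hb; apply: (idealD hN); last exact: (h b 3%N _ hb isT).
    by apply: (idealD hN); [exact: (h b 1%N _ hb isT)|exact: (h b 2%N _ hb isT)].
  apply: (idealM hN); apply: (idealB hN).
    exact: (h1 _ _ (hn _)).
  exact: (h1 _ _ (hn _)).
have hD : C (p * q - r ^+ 2)^-1 * (C p * C q - C r ^+ 2) = 1.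
  by rewrite -!(rmorphM, rmorphXn, rmorphB) mulVf // rmorph1.
have [||||l1 l2 l3] := curv_elim (L1 := L 1%N) (L2 := L 2%N) (L3 := L 3%N) (x := 'X_0 ^+ 2) hN hD.
- by have := rel 1%N 1%N isT isT; rewrite [smat _ _ _ _ _ _]/= mpolyC0 mul0r sub0r.
- by have := rel 1%N 2%N isT isT; rewrite [smat _ _ _ _ 1 (next3 2)]/= mpolyC0 mul0r subr0.
- exact: rel 1%N 3%N isT isT.
- exact: rel 2%N 3%N isT isT.
by case: g => [|[|[|[|g]]]].
Qed.

Lemma row_Qi_sum u : u = \sum_g (u *m Q) 0 g *: row g Qi.
Proof.
rewrite -[LHS]mulmx1 -(mulmxV Q_unit) mulmxA [in LHS](row_sum_delta (u *m Q)) mulmx_suml.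
by apply: eq_bigr => g _; rewrite -scalemxAl -rowE.
Qed.

Lemma x2_lin4 u : (u *m Q) 0 0 = 0 -> N ('X_0 ^+ 2 * lin4 u).
Proof.
move=> u0; rewrite (row_Qi_sum u) linear_sum mulr_sumr.
apply: (ideal_sum _ hN) => g _; rewrite linearZ /= -mul_mpolyC mulrCA.
have [->|ng0] := eqVneq g 0; first by rewrite u0 rmorph0 mul0r; exact: (ideal0 hN).
apply: (idealM hN); rewrite -[g]inord_val; apply: x2_dual.
by case: g ng0 => [[|[|[|[|]]]]].
Qed.

Lemma x3_lin4 u : N ('X_0 ^+ 3 * lin4 u).
Proof.
(* The operator of [X_1] applied to its dual form [L]: then [w] pairs to 1 with [X_0] under [Q], and
   modulo [N] the product of [X_0 ^+ 3] and [w] is [X_1] times [X_0 ^+ 2 * L]. With the forms of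
   [x2_lin4], [w] spans all linear forms. *)
pose w := row (o 1) Qi *m (slice (o 1) *m Qi).
have w1 : (w *m Q) 0 0 = 1.
  rewrite /w -!mulmxA mulVmx // mulmx1 -row_mul [LHS]mxE.
  have -> : (Qi *m slice (o 1)) (o 1) 0 = (slice (o 1) *m Qi) 0 (o 1).
    rewrite -[Qi *m _]trmxK [LHS]mxE trmx_mul tr_slice tr_Qi.
    by [].
  by rewrite (slice_Qi0 Q_unit) eqxx.
have xw : N ('X_0 ^+ 3 * lin4 w).
  have h := mul_lin4 (o 1) (row (o 1) Qi); have h' := @x2_dual 1 isT.
  rewrite (_ : _ * _ = 'X_(o 1) * ('X_0 ^+ 2 * lin4 (row (o 1) Qi)) -
    'X_0 ^+ 2 * ('X_(o 1) * lin4 (row (o 1) Qi) - 'X_0 * lin4 w)); last by ring.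
  by apply: (idealB hN); exact: (idealM hN).
pose c := (u *m Q) 0 0.
have h : N ('X_0 ^+ 2 * lin4 (u - c *: w)).
  apply: x2_lin4; rewrite mulmxBl -scalemxAl.
  have E (A B : 'rV[k]_4) : (A - c *: B) 0 0 = A 0 0 - c * B 0 0 by rewrite !mxE.
  by rewrite E w1 mulr1 subrr.
rewrite (_ : _ * _ = 'X_0 * ('X_0 ^+ 2 * lin4 (u - c *: w)) + C c * ('X_0 ^+ 3 * lin4 w)).
  by apply: (idealD hN); exact: (idealM hN).
rewrite linearB linearZ /= -mul_mpolyC; ring.
Qed.

Lemma monomial_mod d m : mdeg m = d.+1 -> exists u, N ('X_[m] - 'X_0 ^+ d * lin4 u).
Proof.
elim: d m => [|d IHd] m hm.
  have /mdeg1P[i /eqP ->] : mdeg m == 1%N by rewrite hm.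
  exists (delta_mx 0 i); rewrite expr0 mul1r /lin4 (bigD1 i) //= mxE !eqxx scale1r big1 ?addr0.
    by rewrite subrr; exact: (ideal0 hN).
  by move=> l ne; rewrite mxE (negPf ne) andbF scale0r.
have [i mi] : exists i, m i != 0%N.
  apply/existsP; apply: contra_eqT hm => /existsPn h.
  by rewrite mdegE big1 // => i _; have := h i; rewrite negbK => /eqP.
have le1 : (U_(i) <= m)%MM by rewrite lep1mP.
have hm' : mdeg (m - U_(i))%MM = d.+1.
  by apply/eqP; rewrite -eqSS -hm -[in X in _ == X](submK le1) mdegD mdeg1 addn1.
have [u hu] := IHd _ hm'; exists (u *m (slice i *m Qi)).
rewrite -{1}(submK le1) mpolyXD.
rewrite (_ : _ - _ = 'X_i * ('X_[m - U_(i)] - 'X_0 ^+ d * lin4 u) +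
  'X_0 ^+ d * ('X_i * lin4 u - 'X_0 * lin4 (u *m (slice i *m Qi)))); last by rewrite exprS; ring.
by apply: (idealD hN); apply: (idealM hN) => //; exact: mul_lin4.
Qed.

Lemma form_mod d f : f \is d.+1.-homog -> exists u, N (f - 'X_0 ^+ d * lin4 u).
Proof.
move=> /dhomogP hf; rewrite (mpolyE f) big_seq.
apply: (big_ind (fun f => exists u, N (f - 'X_0 ^+ d * lin4 u))).
- by exists 0; rewrite linear0 mulr0 subr0; exact: (ideal0 hN).
- move=> f1 f2 [u1 h1] [u2 h2]; exists (u1 + u2); rewrite linearD /= mulrDr opprD addrACA.
  exact: (idealD hN).
- move=> m mf; have [u hu] := monomial_mod (hf m mf); exists (f@_m *: u).
  by rewrite linearZ /= -scalerAr -scalerBr -mul_mpolyC; exact: (idealM hN).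
Qed.

Lemma X4_in (i : 'I_4) : N ('X_i ^+ 4).
Proof.
have [u hu] := form_mod (dhomogXn k i 4).
by rewrite -['X_i ^+ 4](subrK ('X_0 ^+ 3 * lin4 u)); apply: (idealD hN) => //; exact: x3_lin4.
Qed.

Lemma cubic_ann_ideal : ideal cubic_ann.
Proof.
split=> [g|f g hf hg h|a f hf g]; first by rewrite mul0r linear0.
  by rewrite mulrDl linearD hf hg addr0.
by rewrite mulrAC mulrC; exact: hf.
Qed.

Lemma phi_monomials f : (forall m, phi (f * 'X_[m]) = 0) -> cubic_ann f.
Proof.
move=> h g; rewrite (mpolyE g) mulr_sumr linear_sum big1 // => m _.
by rewrite -scalerAr linearZ /= h scaler0.
Qed.

Lemma dhomogX1 (i : 'I_4) : ('X_i : P) \is 1.-homog.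
Proof. by rewrite dhomogX /= mdeg1. Qed.

Lemma lin4_homog u : lin4 u \is 1.-homog.
Proof. by apply: rpred_sum => i _; apply: rpredZ; exact: dhomogX1. Qed.

Lemma quad_cubic_ann a b : (0 < a <= 3)%N -> (0 < b <= 3)%N -> cubic_ann (quad a b).
Proof.
move=> ha hb; have eE (l : nat) : (0 < l <= 3)%N -> axis (Y 1) (Y 2) (Y 3) l = Y l.
  by case: l => [|[|[|[|l]]]].
rewrite /quadric linform_prodc // !eE //.
set u := row _ _.
have hq : Y a * Y b - x0 * lin4 u \is 2.-homog.
  by rewrite rpredB // -[2%N]/(1 + 1)%N dhomogM ?dhomogX1 ?lin4_homog.
apply: phi_monomials => m; have [/mdeg1P[i /eqP ->]|m1] := boolP (mdeg m == 1%N).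
  rewrite mulrBl linearB /=.
  have -> : phi (x0 * lin4 u * 'X_i) = (u *m Q) 0 i.
    rewrite /lin4 mulr_sumr mulr_suml linear_sum [RHS]mxE; apply: eq_bigr => j _.
    by rewrite -scalerAr -scalerAl linearZ /= [Q j i]mxE.
  rewrite /u -row_mul -mulmxA mulVmx // mulmx1 !mxE /coef3.
  by rewrite subrr.
apply: (@phi_deg (2 + mdeg m)); last by apply: dhomogM; rewrite // dhomogX.
by rewrite -[3%N]/(2 + 1)%N eqn_add2l.
Qed.

Lemma sub_section_ideal f : N f -> cubic_ann f.
Proof.
have hA := cubic_ann_ideal.
have qA := quad_cubic_ann.
have gau := gauss_eqs_map C (gauss_holds Q_unit S13 S23).
have cod := codazzi_eqs_map C (codazzi_holds Q_unit S13 S23).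
case=> c hc; rewrite -[f](subrK (quad 3 3 * c)); apply: (idealD hA); last first.
  by apply: (ideal_mulr _ hA); exact: qA.
apply: (gen_sub hA) hc => g /(nthP 0)[i lti <-].
case: i lti => [|[|[|[|[|i]]]]] // _.
- by rewrite (struct_pf0 _ _ _ _ cod gau); apply: (idealN hA); apply: (idealM hA); exact: qA.
- by rewrite (struct_pf1 _ _ _ _ cod gau); apply: (idealN hA); apply: (idealM hA); exact: qA.
- rewrite (struct_pf2 _ _ _ _ cod gau); apply: (idealN hA).
  by apply: (idealB hA); apply: (idealM hA); exact: qA.
- rewrite (struct_pf3 _ _ _ _ cod gau); apply: (idealN hA).
  by apply: (idealD hA); apply: (idealM hA); exact: qA.
- rewrite (struct_pf4 _ _ _ _ cod gau); apply: (idealN hA).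
  by apply: (idealB hA); apply: (idealM hA); exact: qA.
Qed.

Lemma cubic_ann_homogeneous : homogeneous cubic_ann.
Proof.
move=> d f hf; apply: phi_monomials => m.
have hm : ('X_[m] : P) \is (mdeg m).-homog by rewrite dhomogX.
have [dm|ndm] := eqVneq (d + mdeg m)%N 3%N; last first.
  by apply: (@phi_deg (d + mdeg m)) => //; apply: dhomogM => //; exact: pihomogP.
have phi3 g : phi g = phi (pihomog mdeg 3 g).
  have lt3 : (3 < maxn 4 (mmeasure mdeg g))%N by rewrite leq_max.
  rewrite {1}(@pihomog_partitionE _ _ mdeg _ g (leq_maxr 4 _)).
  rewrite linear_sum (bigD1 (Ordinal lt3)) //=.
  rewrite big1 ?addr0 // => j ne; apply: (@phi_deg j); last exact: pihomogP.
  by apply: contra_neq ne => j3; apply: val_inj.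
rewrite -(hf 'X_[m]) (phi3 (f * _)) mulrC [f * _]mulrC (pihomogMl _ _ hm).
have [le3 e3] : (mdeg m <= 3)%N /\ (3 - mdeg m)%N = d.
  by move: (mdeg m) dm => e <-; rewrite leq_addl addnK.
by rewrite le3 e3.
Qed.

Lemma cubic_annE f : cubic_ann f <-> N f.
Proof.
split=> [hf|]; last exact: sub_section_ideal.
apply: (mem_homogeneous hN) => d.
have := cubic_ann_homogeneous d hf; have := pihomogP mdeg d f.
move: (pihomog mdeg d f) => {hf}f fd hf.
have hA := cubic_ann_ideal.
have uQ u : (forall i, phi ('X_0 * lin4 u * 'X_i) = 0) -> u = 0.
  move=> h; have uQ0 : u *m Q = 0.
    apply/rowP=> i; rewrite [RHS]mxE -(h i) /lin4 mulr_sumr mulr_suml linear_sum [LHS]mxE.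
    by apply: eq_bigr => j _; rewrite -scalerAr -scalerAl linearZ /= mxE.
  by rewrite -[u]mulmx1 -(mulmxV Q_unit) mulmxA uQ0 mul0mx.
case: d fd => [|d] fd.
  suff -> : f = 0 by exact: (ideal0 hN).
  have fC : f = C f@_0.
    apply/mpolyP=> m; rewrite mcoeffC; have [->|m0] := eqVneq m 0%MM; first by rewrite mulr1.
    by rewrite mulr0; apply: (dhomog_nemf_coeff fd); rewrite mdeg_eq0.
  have [f00|f0] := eqVneq f@_0%MM 0; first by rewrite fC f00 mpolyC0.
  have h0 : Q = 0.
    apply/matrixP=> i j; rewrite !mxE /coef3; have := hf ('X_0 * 'X_i * 'X_j).
    rewrite {1}fC mul_mpolyC linearZ /= => /eqP; rewrite scaler_eq0 (negPf f0).
    by move=> /eqP.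
  by move: Q_unit; rewrite h0 unitmxE det0 unitr0.
have [u hu] := form_mod fd.
have hxu : cubic_ann ('X_0 ^+ d * lin4 u).
  rewrite (_ : _ * _ = f - (f - 'X_0 ^+ d * lin4 u)); last by rewrite subKr.
  by apply: (idealB hA) => //; exact: sub_section_ideal.
rewrite -[f](subrK ('X_0 ^+ d * lin4 u)); apply: (idealD hN) => {hu} //.
(* Here [f] has degree [d.+1]. In degrees one and two nondegeneracy of [Q] gives [u = 0]; in degree
   three, testing against 1 gives only that [u] is orthogonal to [X_0], which is what [x2_lin4]
   needs; in higher degrees [x3_lin4] applies to every [u]. *)
case: d fd hxu => [|[|[|d]]] _ hxu.
- rewrite (uQ u) ?linear0 ?mulr0; first exact: (ideal0 hN).
  by move=> i; have := hxu ('X_0 * 'X_i); rewrite expr0 mul1r mulrA [lin4 u * _]mulrC.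
- rewrite (uQ u) ?linear0 ?mulr0; first exact: (ideal0 hN).
  by move=> i; have := hxu 'X_i.
- apply: x2_lin4; have := hxu 1; rewrite mulr1 /lin4 mulr_sumr linear_sum mxE => h.
  rewrite -[RHS]h; apply: eq_bigr => j _; rewrite -scalerAr linearZ /= mxE /coef3.
  by rewrite expr2 mulrAC.
- rewrite -[d.+3]addn3 exprD -mulrA; apply: (idealM hN); exact: x3_lin4.
Qed.

End CubicIdeal.

(** * Transport along ring isomorphisms, and the regular chains in the annihilator *)

(** Everything that the linkage argument uses, stated through ring elements only, so that it can be
    proved in coordinates adapted to [x] and carried over by a ring isomorphism. *)
Definition pfaffian_section (R : comNzRingType) (K : R -> Prop) : Prop :=
  exists (m12 m13 m14 m15 m23 m24 m25 m34 m35 m45 q : R) (s : seq R),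
    let p := pf m12 m13 m14 m15 m23 m24 m25 m34 m35 m45 in
    [/\ size s = 3%N, forall f, f \in s -> gen p f,
        reg_chain (fun f => f = 0) s, reg_chain (fun f => f = 0) (q :: s) &
        forall f, K f <-> adjoin (gen p) q f].

Lemma pfaffian_section_linked (R : comNzRingType) (K : submodClosed R^o) :
  pfaffian_section (fun f => f \in K) -> (1 : R^o) \notin K ->
  generalized_linked_sum 3 K.
Proof.
move=> [m12 [m13 [m14 [m15 [m23 [m24 [m25 [m34 [m35 [m45 [q [s]]]]]]]]]]]].
move=> /= [sz sJ regs [regq regqs] KE] K1.
apply: (@pf_section_linked R m12 m13 m14 m15 m23 m24 m25 m34 m35 m45 s sz sJ regs _ q) => //.
by move=> J1; case/negP: K1; apply/KE; exact: sub_adjoin.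
Qed.

Section Transport.
Variables (R R' : comNzRingType) (g : {rmorphism R -> R'}).
Hypothesis g_bij : bijective g.

Definition corresponds (I : R -> Prop) (I' : R' -> Prop) : Prop :=
  forall f, I' (g f) <-> I f.

Let g_surj f' : exists f, f' = g f.
Proof. by have [h _ hK] := g_bij; exists (h f'); rewrite hK. Qed.

Lemma corresponds_adjoin I I' a :
  corresponds I I' -> corresponds (adjoin I a) (adjoin I' (g a)).
Proof.
move=> II' f; split=> [[c' h]|[c /II' h]]; last by exists (g c); rewrite -rmorphM -rmorphB.
have [c E] := g_surj c'; exists c; apply/II'.
by rewrite rmorphB rmorphM -E.
Qed.

Lemma corresponds_nzdiv I I' a : corresponds I I' -> nzdiv I a -> nzdiv I' (g a).
Proof.
move=> II' ra f'; have [f ->] := g_surj f'.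
by rewrite -rmorphM => /II'/ra/II'.
Qed.

Lemma corresponds_reg_chain I I' s :
  corresponds I I' -> reg_chain I s -> reg_chain I' (map g s).
Proof.
elim: s I I' => //= a s IHs I I' II' [ra rs]; split; first exact: corresponds_nzdiv ra.
exact: IHs (corresponds_adjoin a II') rs.
Qed.

Lemma corresponds_extend I I' s :
  corresponds I I' -> corresponds (extend I s) (extend I' (map g s)).
Proof.
by elim: s I I' => //= a s IHs I I' II'; exact/IHs/corresponds_adjoin.
Qed.

Lemma corresponds0 : corresponds (fun f => f = 0) (fun f => f = 0).
Proof. by move=> f; split=> [|->]; [rewrite -(rmorph0 g) => /(bij_inj g_bij)|rewrite rmorph0]. Qed.

Lemma corresponds_gen s : corresponds (gen s) (gen (map g s)).
Proof. by move=> f; rewrite !genP; apply: corresponds_extend; exact: corresponds0. Qed.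

Lemma pfaffian_section_transport K K' : corresponds K K' ->
  pfaffian_section K -> pfaffian_section K'.
Proof.
move=> KK' [m12 [m13 [m14 [m15 [m23 [m24 [m25 [m34 [m35 [m45 [q [s]]]]]]]]]]]].
move=> /= [sz sJ regs regq KE].
exists (g m12), (g m13), (g m14), (g m15), (g m23), (g m24), (g m25), (g m34),
  (g m35), (g m45), (g q), (map g s) => p.
have pE : p = map g (pf m12 m13 m14 m15 m23 m24 m25 m34 m35 m45).
  by rewrite /p /pf /= !(rmorphN, rmorphB, rmorphD, rmorphM).
split.
- by rewrite size_map.
- by move=> f' /mapP[f fs ->]; rewrite pE; apply/corresponds_gen/sJ.
- exact: corresponds_reg_chain corresponds0 regs.
- exact: (@corresponds_reg_chain _ _ (q :: s)) corresponds0 regq.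
- move=> f'; have [f ->] := g_surj f'; rewrite KK' KE pE.
  by apply: iff_sym; apply: corresponds_adjoin; exact: corresponds_gen.
Qed.

End Transport.

Lemma homogeneous_extend (k : fieldType) n (I : {mpoly k[n.+1]} -> Prop) s :
  ideal I -> homogeneous I -> (forall f, f \in s -> pos_form f) -> homogeneous (extend I s).
Proof.
elim: s I => //= a s IHs I hI hom fs; apply: IHs; first exact: adjoin_ideal.
  by apply: homogeneous_adjoin => //; apply: fs; rewrite mem_head.
by move=> f hf; apply: fs; rewrite inE hf orbT.
Qed.

Section CubicSection.
Variables (k : fieldType) (phi : {linear {mpoly k[4]} -> k^o}).
Local Notation P := {mpoly k[4]}.
Local Notation o := (@inord 3).
Local Notation Q := (slice_mx phi 0).
Local Notation Qi := (invmx (slice_mx phi 0)).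
Local Notation vf := (mulc phi).
Local Notation cv a b c d := (curv phi (o a) (o b) (o c) (o d)).
Local Notation p := (cv 2 3 2 3).
Local Notation q := (cv 3 1 3 1).
Local Notation r := (cv 2 3 3 1).
Local Notation s := (cv 1 2 1 2).

Hypothesis phi_deg : forall d (f : P), d != 3%N -> f \is d.-homog -> phi f = 0.
Hypothesis Q_unit : Q \in unitmx.
Hypothesis S13 : cv 2 3 1 2 = 0.
Hypothesis S23 : cv 3 1 1 2 = 0.
Hypothesis D_neq0 : p * q - r ^+ 2 != 0.

Local Notation C := (@mpolyC 4 k).
Local Notation Y i := ('X_(inord i%N) : P).
Local Notation x0 := ('X_0 : P).
Local Notation vP a b := (C \o vf a b).
Local Notation quad :=
  (quadric x0 (Y 1) (Y 2) (Y 3) (vP 1 1) (vP 1 2) (vP 1 3) (vP 2 2) (vP 2 3) (vP 3 3)).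
Local Notation pfs :=
  (struct_pf x0 (Y 1) (Y 2) (Y 3) (C p) (C q) (C r) (C s)
    (vP 1 1) (vP 1 2) (vP 1 3) (vP 2 2) (vP 2 3) (vP 3 3)).

Lemma quadE a b : (0 < a <= 3)%N -> (0 < b <= 3)%N ->
  quad a b = Y a * Y b - x0 * lin4 (row (o b) (slice_mx phi (o a) *m Qi)).
Proof.
move=> ha hb; have eE (l : nat) : (0 < l <= 3)%N -> axis (Y 1) (Y 2) (Y 3) l = Y l.
  by case: l => [|[|[|[|l]]]].
by rewrite /quadric linform_prodc // !eE.
Qed.

Lemma quad_homog a b : (0 < a <= 3)%N -> (0 < b <= 3)%N -> quad a b \is 2.-homog.
Proof.
move=> ha hb; rewrite quadE // rpredB // -[2%N]/(1 + 1)%N dhomogM ?dhomogX1 ?lin4_homog //.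
Qed.

Lemma pfs_form f : f \in pfs -> pos_form f.
Proof.
have gau := gauss_eqs_map C (gauss_holds Q_unit S13 S23).
have cod := codazzi_eqs_map C (codazzi_holds Q_unit S13 S23).
move=> /(nthP 0)[i lti <-]; exists 2%N => //.
have hC (c : k) g : g \is 2.-homog -> C c * g \is 2.-homog.
  by move=> hg; rewrite mul_mpolyC; exact: rpredZ.
have hq a b : (0 < a <= 3)%N -> (0 < b <= 3)%N -> quad a b \is 2.-homog.
  exact: quad_homog.
have hD : C p * C q - C r ^+ 2 = C (p * q - r ^+ 2).
  by rewrite -!(rmorphM, rmorphXn, rmorphB).
case: i lti => [|[|[|[|[|i]]]]] // _.
- by rewrite (struct_pf0 _ _ _ _ cod gau) hD rpredN; apply: hC; exact: hq.
- by rewrite (struct_pf1 _ _ _ _ cod gau) hD rpredN; apply: hC; exact: hq.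
- rewrite (struct_pf2 _ _ _ _ cod gau) hD -rmorphM rpredN.
  by apply: rpredB; apply: hC; exact: hq.
- rewrite (struct_pf3 _ _ _ _ cod gau) hD -rmorphM rpredN.
  by apply: rpredD; apply: hC; exact: hq.
- rewrite (struct_pf4 _ _ _ _ cod gau) hD -rmorphM rpredN.
  by apply: rpredB; apply: hC; exact: hq.
Qed.

(** [X4_in] writes the fourth power as an element of the Pfaffian ideal plus a multiple of the
    quadric. Both are homogeneous, so degree four components may be taken; [f] must be a form for
    the permutation of regular chains. *)
Lemma X4_form (i : 'I_4) : exists2 f, f \is 4.-homog /\ gen pfs f &
  adjoin (fun g : P => g = 0) (quad 3 3) ('X_i ^+ 4 - f).
Proof.
have [c hc] := X4_in Q_unit S13 S23 D_neq0 i.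
have hom : homogeneous (gen pfs).
  move=> d f; rewrite !genP; apply: homogeneous_extend; first exact: zero_ideal.
    by move=> d' f' ->; rewrite linear0.
  exact: pfs_form.
have h33 : quad 3 3 \is 2.-homog by exact: quad_homog.
have X4 := dhomogXn k i 4.
exists ('X_i ^+ 4 - quad 3 3 * pihomog mdeg 2 c).
  have E : pihomog mdeg 4 ('X_i ^+ 4 - quad 3 3 * c) =
      'X_i ^+ 4 - quad 3 3 * pihomog mdeg 2 c.
    by rewrite linearB /= (pihomog_dE X4) (pihomogMl _ _ h33).
  by rewrite -E; split; [exact: pihomogP|exact: hom].
by exists (pihomog mdeg 2 c); rewrite subKr subrr.
Qed.

Lemma cubic_section : pfaffian_section (cubic_ann phi).
Proof.
pose F i := s2val (cid2 (X4_form i)).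
have F_form i : F i \is 4.-homog /\ gen pfs (F i) by exact: (s2valP (cid2 (X4_form i))).
have F_mod i := s2valP' (cid2 (X4_form i)).
have Fs f : f \in [:: F 0; F (o 1); F (o 2)] -> f \is 4.-homog /\ gen pfs f.
  rewrite !inE => /or3P[] /eqP->.
  - exact: F_form.
  - exact: F_form.
  - exact: F_form.
pose l := lin4 (row (o 3) (slice_mx phi (o 3) *m Qi)).
have q33 : quad 3 3 = Y 3 ^+ 2 - x0 * l by rewrite quadE // expr2.
(* The first 4 is the exponent of the variables; the second works as nilpotency exponent because the
   fourth power of [x0 * l] is divisible by [x0 ^+ 4]. *)
have := @section_reg_chain k 3 4 4 (o 3) (x0 * l) [:: F 0; F (o 1); F (o 2)].
rewrite -q33 => /(_ isT)[|||||regs reg_qs].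
- by rewrite -[2%N]/(1 + 1)%N dhomogM ?dhomogX1 ?lin4_homog.
- have h : mono_ideal 4 (o 3) (x0 ^+ 4).
    move=> m; rewrite mpolyXn mcoeffX; have [<- _|_] := eqVneq (U_(0%R : 'I_4) *+ 4)%MM m; last by rewrite eqxx.
    by exists 0; rewrite ?inordK // mulmnE mnm1E eqxx mul1n.
  by rewrite exprMn; have := ideal_mulr (l ^+ 4) (@mono_ideal_ideal k 3 4 (o 3)) h.
- by rewrite inordK.
- by move=> f /Fs[].
- move=> i; rewrite inordK // => lti3.
  rewrite -[i]inord_val; move: lti3; case: (val i) => [|[|[|]]] // _.
  + by rewrite o0 /=; exact: F_mod.
  + by rewrite inordK //=; exact: F_mod.
  + by rewrite inordK //=; exact: F_mod.
have [m12 [m13 [m14 [m15 [m23 [m24 [m25 [m34 [m35 [m45 pfsE]]]]]]]]]] :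
    exists m12 m13 m14 m15 m23 m24 m25 m34 m35 m45,
      pfs = pf m12 m13 m14 m15 m23 m24 m25 m34 m35 m45.
  by do 10 eexists; reflexivity.
exists m12, m13, m14, m15, m23, m24, m25, m34, m35, m45, (quad 3 3), [:: F 0; F (o 1); F (o 2)].
split=> // f.
  by rewrite -pfsE => /Fs[].
rewrite -pfsE; exact: (cubic_annE phi_deg Q_unit S13 S23 D_neq0).
Qed.

End CubicSection.

(** * A basis with nonzero leading minor and two vanishing off-diagonal entries *)

Section MinorRank.
Variable k : fieldType.

Lemma rank_le1 m n (M : 'M[k]_(m, n)) :
  (forall (a c : 'I_m) (b d : 'I_n), (a < c)%N -> (b < d)%N -> M a b * M c d = M a d * M c b) ->
  (\rank M <= 1)%N.
Proof.
move=> hlt; have h a b c d : M a b * M c d = M a d * M c b.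
  have h' (a' c' : 'I_m) : (a' < c')%N -> M a' b * M c' d = M a' d * M c' b.
    move=> lt_ac; case: (ltngtP b d) => [|lt_db|/val_inj->//]; first exact: hlt.
    exact/esym/hlt.
  case: (ltngtP a c) => [|lt_ca|/val_inj->]; [exact: h'| |exact: mulrC].
  by rewrite mulrC [RHS]mulrC h'.
have [->|/eqP M0] := eqVneq M 0; first by rewrite mxrank0.
have [i [j Mij]] : exists i j, M i j != 0.
  apply: contrapT => nh; case: M0; apply/matrixP=> i j; rewrite mxE.
  by apply/eqP/negPn/negP => ne; apply: nh; exists i, j.
have -> : M = (M i j)^-1 *: (col j M *m row i M).
  apply/matrixP=> a b; rewrite mxE mxE big_ord_recl big_ord0 addr0 !mxE (h a j i b).
  by rewrite mulrC mulfK.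
apply: leq_trans (mxrank_scale _ _) _.
exact: leq_trans (mxrankM_maxr _ _) (rank_leq_row _).
Qed.

Lemma ord3P (P : 'I_3 -> Prop) : P 0 -> P 1 -> P 2%:R -> forall i, P i.
Proof.
move=> P0 P1 P2 [[|[|[|//]]] lti].
- by rewrite (_ : Ordinal lti = 0) //; apply: val_inj.
- by rewrite (_ : Ordinal lti = 1) //; apply: val_inj.
- by rewrite (_ : Ordinal lti = 2%:R) //; apply: val_inj.
Qed.

(* If the diagonal of the adjugate vanishes and its other entries are killed by
   two, then [det^2 = det adj = 0], so that [adj_ij^2 = - s_kk det = 0]. *)
Lemma sym3_minors (s11 s12 s13 s22 s23 s33 : k) :
  s22 * s33 - s23 ^+ 2 = 0 -> s11 * s33 - s13 ^+ 2 = 0 -> s11 * s22 - s12 ^+ 2 = 0 ->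
  (s13 * s23 - s12 * s33) *+ 2 = 0 -> (s12 * s23 - s13 * s22) *+ 2 = 0 ->
  (s12 * s13 - s11 * s23) *+ 2 = 0 ->
  [/\ s13 * s23 = s12 * s33, s12 * s23 = s13 * s22 & s12 * s13 = s11 * s23].
Proof.
move=> b11 b22 b33 b12 b13 b23.
have sq0 (a : k) : a ^+ 2 = 0 -> a = 0 by move/eqP; rewrite expf_eq0 => /eqP.
pose det := s11 * (s22 * s33 - s23 ^+ 2) + s12 * (s13 * s23 - s12 * s33) +
  s13 * (s12 * s23 - s13 * s22).
have det0 : det = 0.
  apply: sq0.
  have -> : det ^+ 2 = (s22 * s33 - s23 ^+ 2) * ((s11 * s33 - s13 ^+ 2) *
      (s11 * s22 - s12 ^+ 2) - (s12 * s13 - s11 * s23) ^+ 2)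
    - (s13 * s23 - s12 * s33) ^+ 2 * (s11 * s22 - s12 ^+ 2)
    - (s12 * s23 - s13 * s22) ^+ 2 * (s11 * s33 - s13 ^+ 2)
    + (s13 * s23 - s12 * s33) *+ 2 * (s12 * s23 - s13 * s22) * (s12 * s13 - s11 * s23).
    by rewrite /det; ring.
  by rewrite b11 b22 b33 b12 !(mul0r, mulr0, subr0, addr0).
split; apply/eqP; rewrite -subr_eq0; apply/eqP/sq0.
- have -> : (s13 * s23 - s12 * s33) ^+ 2 =
    (s22 * s33 - s23 ^+ 2) * (s11 * s33 - s13 ^+ 2) - s33 * det by rewrite /det; ring.
  by rewrite b11 det0 mul0r mulr0 subr0.
- have -> : (s12 * s23 - s13 * s22) ^+ 2 =
    (s22 * s33 - s23 ^+ 2) * (s11 * s22 - s12 ^+ 2) - s22 * det by rewrite /det; ring.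
  by rewrite b11 det0 mul0r mulr0 subr0.
- have -> : (s12 * s13 - s11 * s23) ^+ 2 =
    (s11 * s33 - s13 ^+ 2) * (s11 * s22 - s12 ^+ 2) - s11 * det by rewrite /det; ring.
  by rewrite b22 det0 mul0r mulr0 subr0.
Qed.

End MinorRank.

(* [pr a b c d] stands for [<ab, cd>], and [riem] for the curvature tensor of the
   form [pr] on symmetric squares. *)
Section Curvature.
Variables (k : fieldType) (V : lmodType k) (pr : V -> V -> V -> V -> k).
Hypothesis prC : forall a b c d, pr a b c d = pr b a c d.
Hypothesis pr_sym : forall a b c d, pr a b c d = pr c d a b.
Hypothesis prP : forall l a a' b c d,
  pr (l *: a + a') b c d = l * pr a b c d + pr a' b c d.

Definition riem (b c d g : V) : k := pr c d b g - pr b d c g.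

Lemma riemNl b c d g : riem b c d g = - riem c b d g.
Proof. by rewrite opprB. Qed.

Lemma riem_sym b c d g : riem b c d g = riem d g b c.
Proof.
rewrite /riem (prC g b) (pr_sym b g) (prC d c b g).
by rewrite (prC d b) (pr_sym b d g c) (prC g c) (pr_sym c g).
Qed.

Lemma riemNr b c d g : riem b c d g = - riem b c g d.
Proof. by rewrite riem_sym riemNl riem_sym. Qed.

Lemma riemxx b d g : riem b b d g = 0.
Proof. by rewrite /riem subrr. Qed.

Lemma riemyy b c d : riem b c d d = 0.
Proof. by rewrite riem_sym riemxx. Qed.

Lemma riemD1 l b b' c d g : riem (l *: b + b') c d g = l * riem b c d g + riem b' c d g.
Proof. by rewrite /riem (pr_sym c d) !prP (pr_sym c d b) (pr_sym c d b'); ring. Qed.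

Lemma riemD2 l b c b' d g : riem b (l *: c + b') d g = l * riem b c d g + riem b b' d g.
Proof. by rewrite riemNl riemD1 (riemNl c) (riemNl b'); ring. Qed.

Lemma riemD3 l b c d d' g : riem b c (l *: d + d') g = l * riem b c d g + riem b c d' g.
Proof. by rewrite (riem_sym b) riemD1 (riem_sym d) (riem_sym d'). Qed.

Lemma riemD4 l b c d g g' : riem b c d (l *: g + g') = l * riem b c d g + riem b c d g'.
Proof. by rewrite (riem_sym b) riemD2 (riem_sym d) (riem_sym d). Qed.

(** The leading minor of order two in the basis [a], [b], [c], whose indices stand for the planes
    bc, ca, ab in this order. *)
Definition cofactor3 (a b c : V) : k := riem b c b c * riem c a c a - riem b c c a ^+ 2.

(** Replacing c by a + c changes the plane bc into bc - ab and fixes the other two. The minor is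
    quadratic in this change, so the off-diagonal cofactor comes out doubled. *)
Lemma cofactor3_shift a b c : cofactor3 a b (1 *: a + c) =
  cofactor3 a b c + cofactor3 b c a
  + (riem b c c a * riem c a a b - riem b c a b * riem c a c a) *+ 2.
Proof.
rewrite /cofactor3 !(riemD1, riemD2, riemD3, riemD4) !mul1r !(riemxx, riemyy).
by rewrite !(riemNl b a) !(riemNr _ _ b a) (riem_sym a b c a) (riem_sym a b b c); ring.
Qed.

(** Adding multiples of c to a and b alters neither of the planes bc and ca. *)
Lemma cofactor3_translate l m a b c : cofactor3 (l *: c + a) (m *: c + b) c = cofactor3 a b c.
Proof. by rewrite /cofactor3 !(riemD1, riemD2, riemD3, riemD4) !(riemxx, riemyy) !(mulr0, add0r). Qed.

Lemma curv_translate l m a b c :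
  riem (m *: c + b) c (l *: c + a) (m *: c + b) =
    riem b c a b - m * riem b c c a - l * riem b c b c /\
  riem c (l *: c + a) (l *: c + a) (m *: c + b) =
    riem c a a b - m * riem c a c a - l * riem b c c a.
Proof.
split.
  rewrite !(riemD1, riemD2, riemD3, riemD4) !(riemxx, riemyy) (riemNr _ _ a c) (riemNr _ _ c b).
  by ring.
rewrite !(riemD1, riemD2, riemD3, riemD4) !(riemxx, riemyy) !(riemNr _ _ a c) !(riemNr _ _ c b).
by rewrite (riem_sym c a b c); ring.
Qed.

(** By [curv_translate] the two entries to be killed are affine in [l] and [m], with determinant
    [cofactor3 a b c] up to sign; the witnesses are those of Cramer's rule. *)
Lemma normal_translate a b c : cofactor3 a b c != 0 -> exists l m,
  [/\ cofactor3 (l *: c + a) (m *: c + b) c != 0,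
      riem (m *: c + b) c (l *: c + a) (m *: c + b) = 0 &
      riem c (l *: c + a) (l *: c + a) (m *: c + b) = 0].
Proof.
move=> D0.
exists ((riem b c a b * riem c a c a - riem c a a b * riem b c c a) / cofactor3 a b c).
exists ((riem b c b c * riem c a a b - riem b c c a * riem b c a b) / cofactor3 a b c).
rewrite cofactor3_translate; have [E1 E2] := curv_translate
  ((riem b c a b * riem c a c a - riem c a a b * riem b c c a) / cofactor3 a b c)
  ((riem b c b c * riem c a a b - riem b c c a * riem b c a b) / cofactor3 a b c) a b c.
split=> //.
  by rewrite E1; move: D0; rewrite /cofactor3 => D0; field.
by rewrite E2; move: D0; rewrite /cofactor3 => D0; field.
Qed.

(** [good] stands for forming a basis together with [x]. Rotations and one shift already produce all
    diagonal cofactors and the doubled off-diagonal ones; if all of these vanish, [sym3_minors]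
    forces rank at most one. *)
Lemma cofactor3_neq0_exists (good : V -> V -> V -> Prop) (y z w : V) :
  (forall a b c, good a b c -> good b c a) ->
  (forall a b c, good a b c -> good a b (1 *: a + c)) ->
  good y z w ->
  let b := pr in
  let rows :=
    [:: [:: b z z w w - b z w z w; b z w y w - b y z w w; b y z z w - b z z y w];
        [:: b y w z w - b y z w w; b y y w w - b y w y w; b y z y w - b y y z w];
        [:: b y z z w - b y w z z; b y w y z - b y y z w; b y y z z - b y z y z]] in
  (2 <= \rank (\matrix_(i < 3, j < 3) nth 0%R (nth [::] rows i) j))%N ->
  exists a b c, good a b c /\ cofactor3 a b c != 0.
Proof.
move=> rot shift g /= rk; apply: contrapT => nex.
have D0 a b c : good a b c -> cofactor3 a b c = 0.
  by move=> gabc; apply/eqP/negPn/negP => ne; apply: nex; exists a, b, c.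
have D2 a b c : good a b c -> (riem b c c a * riem c a a b - riem b c a b * riem c a c a) *+ 2 = 0.
  move=> gabc; have := D0 _ _ _ (shift _ _ _ gabc).
  by rewrite cofactor3_shift (D0 _ _ _ gabc) (D0 _ _ _ (rot _ _ _ gabc)) !add0r.
have g1 := rot _ _ _ g; have g2 := rot _ _ _ g1.
have := (D0 _ _ _ g, D0 _ _ _ g1, D0 _ _ _ g2, D2 _ _ _ g, D2 _ _ _ g1, D2 _ _ _ g2).
set M := \matrix_(_, _) _ in rk.
(* The curvature matrix in the planes zw, wy, yz; the entries agree up to the symmetries of [pr],
   and the sign does not affect the rank. *)
have ME : M = - \matrix_(i < 3, j < 3) nth 0 (nth [::]
    [:: [:: riem z w z w; riem z w w y; riem z w y z];
        [:: riem z w w y; riem w y w y; riem w y y z];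
        [:: riem z w y z; riem w y y z; riem y z y z]] i) j.
  apply/matrixP=> i j; rewrite !mxE /riem.
  have prC2 a b c d : pr a b c d = pr a b d c by rewrite pr_sym prC pr_sym.
  elim/ord3P: i; elim/ord3P: j => /=; rewrite opprB; congr (_ - _);
    first [reflexivity | rewrite [LHS]prC; reflexivity | rewrite [LHS]prC2; reflexivity
      | rewrite [LHS]prC [LHS]prC2; reflexivity | rewrite [LHS]pr_sym; reflexivity
      | rewrite [LHS]pr_sym [LHS]prC; reflexivity | rewrite [LHS]pr_sym [LHS]prC2; reflexivity
      | rewrite [LHS]pr_sym [LHS]prC [LHS]prC2; reflexivity].
suff : (\rank M <= 1)%N by rewrite leqNgt rk.
rewrite ME mxrank_opp {M ME rk}.
have := (D0 _ _ _ g, D0 _ _ _ g1, D0 _ _ _ g2, D2 _ _ _ g, D2 _ _ _ g1, D2 _ _ _ g2).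
rewrite /cofactor3 (riem_sym y z z w) (riem_sym w y z w) (riem_sym y z w y).
move: (riem z w z w) (riem z w w y) (riem z w y z) (riem w y w y) (riem w y y z) (riem y z y z).
move=> s11 s12 s13 s22 s23 s33 [[[[[d3 d1] d2] c13] c12] c23].
have [] := @sym3_minors k s11 s12 s13 s22 s23 s33 => //.
- by rewrite mulrC.
- by rewrite [s13 * _]mulrC.
- by rewrite [s12 * s13]mulrC [s11 * _]mulrC.
move=> h12 h13 h23.
apply: rank_le1 => i l j m; rewrite !mxE.
have e1 : s22 * s33 = s23 * s23 by apply/eqP; rewrite -subr_eq0 d1.
have e2 : s11 * s33 = s13 * s13 by apply/eqP; rewrite -subr_eq0 [s11 * _]mulrC d2.
have e3 : s11 * s22 = s12 * s12 by apply/eqP; rewrite -subr_eq0 d3.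
elim/ord3P: i; elim/ord3P: l => //=; elim/ord3P: j; elim/ord3P: m => //= _ _.
- by rewrite -h23 mulrC.
- by rewrite h13 mulrC.
- by rewrite -h12 mulrC.
Qed.

End Curvature.

(** * The pairing of the statement, expressed through a cubic form in adapted coordinates *)

Section NormalForm.
Variables (k : fieldType) (U : vectType k) (hU : \dim {:U} = 4%N).
Variables (Phi : DP k 3 3) (x : U).
Hypothesis hlin : forall u : U, val (lin hU u) \in Ann Phi -> u = 0.
Hypothesis hWL : weak_lefschetz (Ann Phi) (lin hU x).
Local Notation P := {mpoly k[4]}.

Definition cubic (f : P) : k^o := Phi (hcomp 3 f).

Lemma cubic_linear : linear cubic.
Proof.
move=> a f g; rewrite /cubic -linearP; congr (Phi _).
by apply: val_inj; rewrite /= linearP.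
Qed.

HB.instance Definition _ := GRing.isLinear.Build k P k^o _ cubic cubic_linear.

Lemma AnnE f : f \in Ann Phi <-> forall g, cubic (f * g) = 0.
Proof. by split=> [/annP|h]; [|apply/annP]. Qed.

Lemma cubic_deg d f : d != 3%N -> f \is d.-homog -> cubic f = 0.
Proof.
move=> nd fd; rewrite /cubic (_ : hcomp 3 f = 0) ?linear0 //.
by apply: val_inj; rewrite /= (pihomog_ne0 nd fd).
Qed.

Definition ulin (u : U) : P := val (lin hU u).

Lemma ulin_linear : linear ulin.
Proof. by move=> a u v; rewrite /ulin lin_linear linearP. Qed.

HB.instance Definition _ := GRing.isLinear.Build k U P _ ulin ulin_linear.

Lemma ulin_homog u : ulin u \is 1.-homog.
Proof. exact: valP. Qed.

Definition trilin (u v w : U) : k := cubic (ulin u * ulin v * ulin w).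

Lemma trilinC u v w : trilin u v w = trilin v u w.
Proof. by rewrite /trilin [ulin u * _]mulrC. Qed.

Lemma trilinCA u v w : trilin u v w = trilin u w v.
Proof. by rewrite /trilin mulrAC. Qed.

Lemma pmap_val u (s : Sym k 3 1) : Defs.pmap hU Phi x u s = cubic (ulin x * (ulin u * val s)).
Proof.
rewrite pmapE; apply: etrans (@contrE k 3 1 2 (lin hU u) (contr (lin hU x) Phi) s) _.
rewrite [LHS](@contrE k 3 1 3 (lin hU x) Phi) /cubic; congr (Phi _); apply: val_inj => /=.
rewrite (pihomogMl _ _ (ulin_homog x)) (pihomogMl _ _ (ulin_homog x)) /=.
by rewrite pihomog_id.
Qed.

Lemma cubicMl f g : f \is 1.-homog -> cubic (f * g) = cubic (f * pihomog mdeg 2 g).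
Proof.
move=> hf; rewrite /cubic; congr (Phi _); apply: val_inj => /=.
by rewrite !(pihomogMl _ _ hf) pihomog_id.
Qed.

Lemma cubicM2l f g : f \is 2.-homog -> cubic (f * g) = cubic (f * pihomog mdeg 1 g).
Proof.
move=> hf; rewrite /cubic; congr (Phi _); apply: val_inj => /=.
by rewrite !(pihomogMl _ _ hf) pihomog_id.
Qed.

(** If [x * u] annihilates [Phi], either form of maximal rank in degree one gives [u = 0]:
    injectivity at once, and surjectivity because every quadric is [x * s] modulo the annihilator,
    so that [u] times it is killed by the cubic. *)
Lemma pmap_inj : lker (Defs.pmap hU Phi x) == 0%VS.
Proof.
apply/lker0P; suff inj0 u : Defs.pmap hU Phi x u = 0 -> u = 0.
  move=> u v E; apply/eqP; rewrite -subr_eq0; apply/eqP/inj0.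
  by rewrite linearB /= E subrr.
move=> pu0.
have xu s : s \is 1.-homog -> cubic (ulin x * ulin u * s) = 0.
  by move=> hs; have := congr1 (fun h : DP k 3 1 => h (DHomog hs)) pu0; rewrite pmap_val lfunE /= mulrA.
have xuA : (ulin x * ulin u : P) \in Ann Phi.
  apply/AnnE => g; rewrite cubicM2l ?(dhomogM (ulin_homog x) (ulin_homog u)) //.
  by apply: xu; exact: pihomogP.
case: (hWL 1) => [inj1|surj1].
  apply: hlin; rewrite -[val _]subr0; apply/qpiP; rewrite linear0; apply: inj1; first by exists (lin hU u).
  by rewrite -linearZ -(linear0 (qpi (Ann Phi))); apply/qpiP; rewrite subr0.
apply: hlin; apply/AnnE => g; rewrite cubicMl ?ulin_homog //.
have hg := pihomogP mdeg 2 g; move: (pihomog mdeg 2 g) hg => h hg.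
have [|_ [s ->] E] := surj1 (qpi (Ann Phi) h); first by exists (DHomog hg).
move: E; rewrite -linearZ => /qpiP/AnnE E.
have -> : ulin u * h = (h - ulin x * val s) * ulin u + ulin x * ulin u * val s by ring.
by rewrite linearD /= E add0r; apply: xu; exact: valP.
Qed.

Definition vprod (u v : U) : U := ((Defs.pmap hU Phi x)^-1)%VF (contr (sq hU u v) Phi).

Lemma vprodP u v w : trilin x (vprod u v) w = trilin u v w.
Proof.
have limgT : limg (Defs.pmap hU Phi x) = fullv.
  apply/eqP; rewrite eqEdim subvf limg_dim_eq; last by rewrite (eqP pmap_inj) capv0.
  by rewrite hU dimvf.
have mem : contr (sq hU u v) Phi \in limg (Defs.pmap hU Phi x) by rewrite limgT memvf.
have := congr1 (fun h : DP k 3 1 => h (lin hU w)) (limg_lfunVK mem).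
rewrite pmap_val => E; rewrite /trilin -mulrA [LHS]E.
exact: (@contrE k 3 2 3 (sq hU u v) Phi (lin hU w)).
Qed.

Definition ucoords : 4.-tuple U := tcast hU (vbasis {:U}).

Lemma ucoords_basis : basis_of {:U} ucoords.
Proof. by rewrite /ucoords val_tcast; exact: vbasisP. Qed.

Lemma ulinE u : ulin u = lin4 (\row_i coord ucoords i u).
Proof.
have E : lin4 (\row_i coord ucoords i u) = \sum_(i < 4) coord ucoords i u *: 'X_i.
  by apply: eq_bigr => i _; rewrite mxE.
by rewrite /ulin /= -E; apply: pihomog_dE; exact: lin4_homog.
Qed.

Lemma ulin_ucoords (i : 'I_4) : ulin (tnth ucoords i) = 'X_i.
Proof.
have fr := basis_free ucoords_basis.
rewrite ulinE /lin4 (bigD1 i) //= mxE (tnth_nth 0) coord_free // eqxx scale1r.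
by rewrite big1 ?addr0 // => j ne; rewrite mxE coord_free // eq_sym (negPf ne) scale0r.
Qed.

Lemma ulin_surj f : f \is 1.-homog -> exists u, ulin u = f.
Proof.
move=> hf; exists (\sum_i f@_U_(i) *: tnth ucoords i).
rewrite linear_sum; under eq_bigr do rewrite linearZ /= ulin_ucoords.
apply/mpolyP=> m; rewrite linear_sum /=.
have [/mdeg1P[j /eqP ->]|m1] := boolP (mdeg m == 1%N).
  rewrite (bigD1 j) //= mcoeffZ mcoeffXU eqxx mulr1 big1 ?addr0 // => i ne.
  by rewrite mcoeffZ mcoeffXU (negPf ne) mulr0.
rewrite (dhomog_nemf_coeff hf m1) big1 // => i _; rewrite mcoeffZ mcoeffX.
by case: eqP => [E|]; [move: m1; rewrite -E mdeg1|rewrite mulr0].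
Qed.

Lemma trilin_inj u v : (forall w, trilin x u w = trilin x v w) -> u = v.
Proof.
move=> h; move/lker0P: pmap_inj; apply; apply/lfunP => s.
have [w E] := ulin_surj (valP s); rewrite !pmap_val !mulrA -E.
exact: h.
Qed.

Lemma trilinP a u u' v w : trilin (a *: u + u') v w = a * trilin u v w + trilin u' v w.
Proof. by rewrite /trilin linearP mulrDl mulrDl -!scalerAl linearP. Qed.

Lemma trilin0 v w : trilin 0 v w = 0.
Proof. by rewrite /trilin [ulin 0]linear0 !mul0r linear0. Qed.

Lemma trilin_sum n (c : 'I_n -> k) (X : 'I_n -> U) v w :
  trilin (\sum_i c i *: X i) v w = \sum_i c i * trilin (X i) v w.
Proof.
elim/big_rec2: _ => [|i a b _ <-]; [exact: trilin0|exact: trilinP].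
Qed.

Definition sqpair (a b c d : U) : k := trilin a b (vprod c d).

Lemma pairingE a b c d : pairing hU Phi x (sq hU a b) (sq hU c d) = sqpair a b c d.
Proof.
rewrite /pairing (@contrE k 3 3 3); congr (Phi _); apply: val_inj => /=.
by rewrite (pihomog_dE (dhomog1 _ _)) mulr1.
Qed.

Lemma sqpair_vprod a b c d : sqpair a b c d = trilin x (vprod a b) (vprod c d).
Proof. by rewrite vprodP. Qed.

Lemma sqpairC a b c d : sqpair a b c d = sqpair b a c d.
Proof. exact: trilinC. Qed.

Lemma sqpair_sym a b c d : sqpair a b c d = sqpair c d a b.
Proof. by rewrite !sqpair_vprod trilinCA. Qed.

Lemma sqpairP l a a' b c d : sqpair (l *: a + a') b c d = l * sqpair a b c d + sqpair a' b c d.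
Proof. exact: trilinP. Qed.

End NormalForm.

Lemma comp_mpolyA (k : fieldType) n (t t' : n.-tuple {mpoly k[n]}) f :
  (f \mPo t) \mPo t' = f \mPo [tuple tnth t i \mPo t' | i < n].
Proof.
rewrite (comp_mpolyEX f t) linear_sum [RHS]comp_mpolyEX; apply: eq_bigr => m _.
rewrite linearZ /= !comp_mpolyX rmorph_prod; congr (_ *: _); apply: eq_bigr => i _.
by rewrite rmorphXn /= tnth_mktuple.
Qed.

Lemma comp_mpoly_homog (k : fieldType) n (t : n.-tuple {mpoly k[n]}) d f :
  (forall i, tnth t i \is 1.-homog) -> f \is d.-homog -> f \mPo t \is d.-homog.
Proof.
move=> ht /dhomogP hf; rewrite comp_mpolyEX big_seq; apply: rpred_sum => m mf.
apply: rpredZ; rewrite comp_mpolyX -(hf m mf) /= mdegE.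
elim/big_rec2: _ => [|i e g _ hg]; first exact: dhomog1.
by apply: dhomogM => //; rewrite -[X in X.-homog for _]mul1n; exact: dhomogMn.
Qed.

Section Coordinates.
Variables (k : fieldType) (U : vectType k) (hU : \dim {:U} = 4%N).
Variables (Phi : DP k 3 3) (x : U).
Hypothesis hlin : forall u : U, val (lin hU u) \in Ann Phi -> u = 0.
Hypothesis hWL : weak_lefschetz (Ann Phi) (lin hU x).
Local Notation P := {mpoly k[4]}.
Local Notation lf := (ulin hU).
Local Notation tri := (trilin hU Phi).
Local Notation pr := (sqpair hU Phi x).
Local Notation coords := (ucoords hU).

Variable B : 4.-tuple U.
Hypothesis B_basis : basis_of {:U} B.
Hypothesis B0 : tnth B 0 = x.

(** The ambient variables come from an unspecified basis of [U]; this substitution makes the members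
    of [B] the variables, with [x] as the zeroth. *)
Definition subst_basis : {lrmorphism P -> P} :=
  comp_mpoly [tuple lf (tnth B i) | i < 4].

Local Notation ev := subst_basis.

Lemma subst_basisX i : ev 'X_i = lf (tnth B i).
Proof. by rewrite /= comp_mpolyXU -tnth_nth tnth_mktuple. Qed.

Lemma subst_basis_bij : bijective ev.
Proof.
pose t' := [tuple lin4 (\row_j coord B j (tnth coords i)) | i < 4].
have lfB u : lf u = \sum_j coord B j u *: lf (tnth B j).
  rewrite {1}(coord_basis B_basis (memvf u)) linear_sum; apply: eq_bigr => j _.
  by rewrite linearZ /= (tnth_nth 0).
have evL (c : 'rV_4) : ev (lin4 c) = \sum_j c 0 j *: lf (tnth B j).
  rewrite /lin4 linear_sum; apply: eq_bigr => j _.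
  by rewrite linearZ /= -subst_basisX.
exists (comp_mpoly t') => f; rewrite /= comp_mpolyA -[RHS]comp_mpoly_id; congr (f \mPo _);
  apply: eq_from_tnth => i; rewrite !tnth_mktuple.
  rewrite ulinE /lin4 linear_sum (eq_bigr (fun j => \sum_l (coord coords j (tnth B i) * coord B l (tnth coords j)) *: 'X_l)).
    rewrite exchange_big /=.
    rewrite (eq_bigr (fun l => coord B l (tnth B i) *: 'X_l)) => [|l _].
      rewrite (bigD1 i) //= (tnth_nth 0) coord_free ?(basis_free B_basis) // eqxx scale1r.
      rewrite big1 ?addr0 // => j ne; rewrite coord_free ?(basis_free B_basis) //.
      by rewrite eq_sym (negPf ne) scale0r.
    rewrite -scaler_suml; congr (_ *: _).
    rewrite [in RHS](coord_basis (ucoords_basis hU) (memvf (tnth B i))) linear_sum.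
    by apply: eq_bigr => j _; rewrite linearZ /= -tnth_nth.
  move=> j _; rewrite linearZ /= mxE comp_mpolyXU -tnth_nth tnth_mktuple /lin4 scaler_sumr.
  by apply: eq_bigr => l _; rewrite mxE scalerA.
have := evL (\row_j coord B j (tnth coords i)).
under eq_bigr do rewrite mxE; rewrite -lfB ulin_ucoords => <-.
by [].
Qed.

Local Notation phi := (cubic Phi \o ev : {linear P -> k^o}).

Lemma phi_deg d f : d != 3%N -> f \is d.-homog -> phi f = 0.
Proof.
move=> nd hf; rewrite /=; apply: (@cubic_deg _ Phi d) => //; apply: comp_mpoly_homog hf => i.
by rewrite tnth_mktuple; exact: ulin_homog.
Qed.

Lemma coef3E i j l : coef3 phi i j l = tri (tnth B i) (tnth B j) (tnth B l).
Proof. by rewrite /coef3 /trilin -!subst_basisX /= !rmorphM. Qed.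

Lemma slice_vec (u : 'rV[k]_4) (j i : 'I_4) :
  (u *m slice_mx phi i) 0 j = tri (tnth B i) (\sum_l u 0 l *: tnth B l) (tnth B j).
Proof.
rewrite mxE trilinC trilin_sum; apply: eq_bigr => l _.
by rewrite mxE coef3E trilinC.
Qed.

Lemma B_ext u v : (forall i, tri x u (tnth B i) = tri x v (tnth B i)) -> u = v.
Proof.
move=> h; apply: (trilin_inj hlin hWL) => w.
have E u' : tri x u' w = \sum_i coord B i w * tri x u' (tnth B i).
  rewrite trilinCA trilinC {1}(coord_basis B_basis (memvf w)) trilin_sum.
  by apply: eq_bigr => i _; rewrite trilinC trilinCA -tnth_nth.
by rewrite !E; apply: eq_bigr => i _; rewrite h.
Qed.

Lemma slice0_unit : slice_mx phi 0 \in unitmx.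
Proof.
rewrite -row_free_unit; apply: inj_row_free => u u0.
have : \sum_l u 0 l *: tnth B l = 0.
  apply: B_ext => i; rewrite [RHS]trilinC trilin0 -{1}B0 -slice_vec u0.
  by rewrite mxE.
under eq_bigr do rewrite (tnth_nth 0).
have /freeP fr := basis_free B_basis; move=> /fr h.
by apply/rowP=> l; rewrite mxE h.
Qed.

Lemma cpairE a b c d :
  cpair phi a b c d = pr (tnth B a) (tnth B b) (tnth B c) (tnth B d).
Proof.
pose c' := row d (slice_mx phi c) *m invmx (slice_mx phi 0).
have E : vprod hU Phi x (tnth B c) (tnth B d) = \sum_l c' 0 l *: tnth B l.
  apply: B_ext => i; rewrite (vprodP hlin hWL) -[in RHS]B0 -slice_vec /c'.
  (* Nondegeneracy makes the solution of [vprodP] unique, so the matrix formula computes [vprod]. *)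
  by rewrite -mulmxA mulVmx ?slice0_unit // mulmx1 !mxE coef3E.
rewrite cpair_sym /sqpair E trilinCA -slice_vec /c' /cpair -!row_mul [RHS]mxE.
by [].
Qed.

Lemma curvE a b c d :
  curv phi a b c d = riem pr (tnth B a) (tnth B b) (tnth B c) (tnth B d).
Proof. by rewrite /curv !cpairE. Qed.

Lemma Ann_pfaffian_section :
  cofactor3 pr (tnth B (inord 1)) (tnth B (inord 2)) (tnth B (inord 3)) != 0 ->
  riem pr (tnth B (inord 2)) (tnth B (inord 3)) (tnth B (inord 1)) (tnth B (inord 2)) = 0 ->
  riem pr (tnth B (inord 3)) (tnth B (inord 1)) (tnth B (inord 1)) (tnth B (inord 2)) = 0 ->
  pfaffian_section (fun f => f \in Ann Phi).
Proof.
move=> D0 S13 S23.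
have := @cubic_section k phi phi_deg slice0_unit.
rewrite !curvE => /(_ S13 S23 D0) sec.
apply: (@pfaffian_section_transport _ _ ev subst_basis_bij (cubic_ann phi) _ _ sec) => f.
split=> [/AnnE h g|h]; first by rewrite /= rmorphM; exact: h.
apply/AnnE => g; have [ev' _ evK] := subst_basis_bij.
by rewrite -(evK g) -rmorphM; exact: h.
Qed.

End Coordinates.

Theorem theorem13p9 (k : fieldType) (U : vectType k) (hU : \dim {:U} = 4%N)
  (Phi : DP k 3 3)
  (hlin : forall u : U, val (lin hU u) \in Ann Phi -> u = 0)
  (x : U) (hWL : weak_lefschetz (Ann Phi) (lin hU x))
  (xs : 'Hom(U, k^o)) (hxs : xs x = 1)
  (y z w : U) (hyzw : basis_of (lker xs) [:: y; z; w])
  (hrank : (2 <= \rank (SM hU Phi x y z w))%N) :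
  generalized_linked_sum 3 (Ann Phi).
Proof.
have n1 : (1 : {mpoly k[4]}^o) \notin Ann Phi.
  apply/negP => h1; have x0 : x = 0.
    by apply: hlin; rewrite -[val _]mulr1; exact: rpredZ.
  by move/eqP: hxs; rewrite x0 linear0 eq_sym oner_eq0.
apply: pfaffian_section_linked n1.
(* Four vectors in dimension four form a basis once they span, so each change of basis below needs
   only the old vectors in the new span. *)
pose good a b c := basis_of {:U} [:: x; a; b; c].
have good_sub a b c a' b' c' : good a b c ->
    {subset [:: a; b; c] <= <<[:: x; a'; b'; c']>>%VS} -> good a' b' c'.
  rewrite /good !basisEdim hU !andbT => full sub; apply: subv_trans full _.
  apply/span_subvP => u; rewrite inE => /predU1P[->|]; last exact: sub.
  by apply: memv_span; rewrite mem_head.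
have g0 : good y z w.
  rewrite /good basisEdim hU andbT; apply/subvP => u _.
  rewrite span_cons -[u](subrK (xs u *: x)) addrC memv_add //.
    by apply: memvZ; exact: memv_line.
  rewrite (span_basis hyzw) memv_ker linearB linearZ /= hxs.
  by rewrite -[X in _ - X]/(xs u * 1) mulr1 subrr.
have rot a b c : good a b c -> good b c a.
  move=> /good_sub; apply=> u; rewrite !inE => uabc; apply: memv_span.
  by rewrite !inE; case/or3P: uabc => ->; rewrite ?orbT.
have mem (s : seq U) l u v : l *: u + v \in s -> u \in s -> v \in <<s>>%VS.
  move=> uvs us; rewrite -[v](addKr (l *: u)) addrC.
  by apply: rpredB; [|apply: rpredZ]; exact: memv_span.
have shift1 l a b c : good a b c -> good (l *: c + a) b c.
  move=> /good_sub; apply=> u; rewrite !inE => /or3P[]/eqP->.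
  - by apply: (@mem _ l c); rewrite !inE eqxx ?orbT.
  - by apply: memv_span; rewrite !inE eqxx ?orbT.
  - by apply: memv_span; rewrite !inE eqxx ?orbT.
have shift2 l a b c : good a b c -> good a (l *: c + b) c.
  move=> /good_sub; apply=> u; rewrite !inE => /or3P[]/eqP->.
  - by apply: memv_span; rewrite !inE eqxx ?orbT.
  - by apply: (@mem _ l c); rewrite !inE eqxx ?orbT.
  - by apply: memv_span; rewrite !inE eqxx ?orbT.
have shift3 a b c : good a b c -> good a b (1 *: a + c).
  move=> /good_sub; apply=> u; rewrite !inE => /or3P[]/eqP->.
  - by apply: memv_span; rewrite !inE eqxx ?orbT.
  - by apply: memv_span; rewrite !inE eqxx ?orbT.
  - by apply: (@mem _ 1 a); rewrite !inE eqxx ?orbT.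
have prS := sqpair_sym hlin hWL; have prL := @sqpairP _ _ hU Phi x.
have [|a [b [c [g D0]]]] := @cofactor3_neq0_exists k U (sqpair hU Phi x)
  (@sqpairC _ _ hU Phi x) prS prL good y z w rot shift3 g0.
  apply: leq_trans hrank _; rewrite /SM; apply: eq_leq; congr (\rank _).
  by apply/matrixP=> i j; rewrite !mxE !pairingE.
have [l [m [D1 S13 S23]]] :=
  @normal_translate k U (sqpair hU Phi x) (@sqpairC _ _ hU Phi x) prS prL a b c D0.
have {g} B_basis : good (l *: c + a) (m *: c + b) c by apply: shift1; apply: shift2.
pose B := [tuple x; l *: c + a; m *: c + b; c].
have B1 : tnth B (inord 1) = l *: c + a by rewrite (tnth_nth 0) inordK.
have B2 : tnth B (inord 2) = m *: c + b by rewrite (tnth_nth 0) inordK.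
have B3 : tnth B (inord 3) = c by rewrite (tnth_nth 0) inordK.
have := @Ann_pfaffian_section k U hU Phi x hlin hWL B B_basis erefl.
rewrite B1 B2 B3; exact.
Qed.
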